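(* There is an efficient non-adaptive quantum algorithm that solves (with high probability) the hidden translation problem with parameter $\epsilon$ on $n$ qubits, which uses $O\left((\log n)/\epsilon\right)$ copies of the unknown state, runs in polynomial time, and requires only circuits of depth $O(n\log n)$ acting coherently on only a single copy at a time, using $O(\log n)$ additional auxiliary systems (qubits).
   Context: Consider $n$ qubits on a ring, with Hilbert space $(\mathbb{C}^2)^{\otimes n}$, and the translation operator $T|x_1,x_2,\ldots,x_n\rangle=|x_n,x_1,\ldots,x_{n-1}\rangle$, so that $k\mapsto T^k$ is a unitary representation of $\mathbb{Z}_n$. Hidden translation problem with parameter $\epsilon>0$: one is given copies of an unknown unit vector $|\psi\rangle\in(\mathbb{C}^2)^{\otimes n}$ such that for some unknown subgroup $H\le\mathbb{Z}_n$ one has $T^k|\psi\rangle=|\psi\rangle$ for all $k\in H$ and $|\langle\psi|T^k|\psi\rangle|<1-\epsilon$ for all $k\in\mathbb{Z}_n\setminus H$. The task is to identify $H$. ''Non-adaptive'' means that the same measurement is performed repeatedly and independently of earlier outcomes, followed by classical post-processing. ''With high probability'' means with success probability at least a fixed constant such as $2/3$. ''Polynomial time'' means polynomial in $n$ and $1/\epsilon$. Circuit depth is counted in gates acting on a constant number of qubits (including controlled-SWAPs), assuming all-to-all connectivity. The $O(\cdot)$ hides absolute constants. *)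

(* Defs.v *)
From mathcomp Require Import all_boot all_order all_algebra all_fingroup.
From mathcomp Require Import complex.
From mathcomp Require Import reals.

Set Implicit Arguments.
Unset Strict Implicit.
Unset Printing Implicit Defensive.

Import Order.TTheory GRing.Theory Num.Theory.
Local Open Scope ring_scope.

(** * Qubits, states and the hidden translation promise *)

Definition bits (N : nat) := {ffun 'I_N -> bool}.

(* Vectors of (C^2)^{(x) N}, by coordinates in the computational basis. *)
Definition state (R : realType) (N : nat) := {ffun bits N -> R[i]}.

Definition inner (R : realType) N (phi psi : state R N) : R[i] :=
  \sum_x (phi x)^* * psi x.

(* (x_1, x_2, ..., x_n) |-> (x_n, x_1, ..., x_(n-1)); ord_pred is the cyclic
   predecessor on 'I_n. *)
Definition shift n (x : bits n) : bits n := [ffun i => x (ord_pred i)].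

(* The linear extension of T |x> = |shift x>. *)
Definition transl (R : realType) n (psi : state R n) : state R n :=
  [ffun y : bits n => \sum_(x | shift x == y) psi x].

(* For n >= 1 this is 'I_n with its additive group structure; unlike 'Z_n it
   is also right for n = 1.  Being a multiplicative finGroupType for MathComp,
   it has <[k]> = {0, k, 2k, ...} and its subgroups are the {group Zn n}. *)
Notation Zn n := 'I_(n.-1.+1).

Definition hidden_translation (R : realType) (n : nat) (eps : R)
    (H : {group Zn n}) (psi : state R n) : Prop :=
  [/\ inner psi psi = 1,
      forall k : Zn n, k \in H -> iter k (@transl R n) psi = psi &
      forall k : Zn n, k \notin H ->
        `| inner psi (iter k (@transl R n) psi) | < (1 - eps)%:C%C ].

(** * Quantum circuits *)

(* The rows and columns of the matrix are indexed by the basis states, through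
   enum_rank. *)
Record gate (R : realType) := Gate {
  arity : nat;
  gmx : 'M[R[i]]_#|{: bits arity}| }.

(* Algebraic entries: the usual condition which prevents noncomputable (or
   hard to compute) information from being hidden in the gates themselves. *)
Definition valid_gate (R : realType) (g : gate R) : Prop :=
  gmx g \is unitarymx /\
  forall i j, algebraicOver (ratr : rat -> R[i]) (gmx g i j).

Record gapp (R : realType) K (G : 'I_K -> gate R) (N : nat) := GApp {
  gid : 'I_K;
  wires : (arity (G gid)).-tuple 'I_N }.

(* Together with a finite family G, the gates act on boundedly many qubits.
   A circuit is a list of layers; the gates of one layer act simultaneously,
   on disjoint sets of qubits, with no locality constraint. *)
Definition circuit (R : realType) K (G : 'I_K -> gate R) (N : nat) :=
  seq (seq (gapp G N)).

Section Circuits.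
Context {R : realType} {K : nat} {G : 'I_K -> gate R}.

Definition wf_circuit N (c : circuit G N) : bool :=
  all (fun l => uniq (flatten [seq val (wires o) | o <- l])) c.

Definition depth N (c : circuit G N) : nat := size c.

Definition gate_count N (c : circuit G N) : nat := sumn (map size c).

Definition bits_at N a (w : a.-tuple 'I_N) (x : bits N) : bits a :=
  [ffun j => x (tnth w j)].

(* x with the bits at positions w replaced by y. *)
Definition overwrite N a (w : a.-tuple 'I_N) (y : bits a) (x : bits N) :
    bits N :=
  [ffun i => if [pick j | tnth w j == i] is Some j then y j else x i].

Definition apply_gate N (psi : state R N) (o : gapp G N) : state R N :=
  [ffun x : bits N => \sum_(y : bits (arity (G (gid o))))
     gmx (G (gid o)) (enum_rank (bits_at (wires o) x)) (enum_rank y)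
     * psi (overwrite (wires o) y x)].

Definition run_circuit N (c : circuit G N) (psi : state R N) : state R N :=
  foldl (fun phi l => foldl (@apply_gate N) phi l) psi c.

(* |psi> (x) |0^a>, with auxiliary qubits n, ..., n + a - 1. *)
Definition with_ancillas n a (psi : state R n) : state R (n + a) :=
  [ffun x : bits (n + a) => if [forall i : 'I_a, ~~ x (rshift n i)]
             then psi [ffun i => x (lshift a i)] else 0].

(* Born rule: probability of the outcome y when all the n + a qubits are
   measured in the computational basis after running c on one copy of psi. *)
Definition outcome_prob n a (c : circuit G (n + a)) (psi : state R n)
    (y : bits (n + a)) : R :=
  let z := run_circuit c (with_ancillas a psi) y in
  complex.Re z ^+ 2 + complex.Im z ^+ 2.

(* Descriptions of circuits as lists of numbers, as produced by a classical
   computation. *)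
Definition encode_gapp N (o : gapp G N) : seq nat :=
  nat_of_ord (gid o) :: [seq nat_of_ord i | i <- wires o].

Definition encode_layer N (l : seq (gapp G N)) : seq nat :=
  size l :: flatten (map (@encode_gapp N) l).

Definition encode_circuit N (c : circuit G N) : seq nat :=
  size c :: flatten (map (@encode_layer N) c).

End Circuits.

Definition encode_bits N (y : bits N) : seq nat :=
  [seq nat_of_bool (y i) | i <- enum 'I_N].

(** * Classical computation *)

(* Structured random access machine: registers and a memory holding natural
   numbers, indirect addressing, addition and truncated subtraction at unit
   cost.  There is no unit-cost multiplication, so bit lengths grow by
   at most one per step (up to the constants of the program), and polynomial
   time here is the same as on Turing machines. *)
Inductive cmd : Type :=
| Skip
| Const of nat & nat          (* r_x := c *)
| Add of nat & nat & nat      (* r_x := r_y + r_z *)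
| Sub of nat & nat & nat      (* r_x := r_y - r_z *)
| Get of nat & nat           (* r_x := mem[r_y] *)
| Put of nat & nat          (* mem[r_x] := r_y *)
| Seq of cmd & cmd
| If of nat & cmd & cmd       (* branch on r_x <> 0 *)
| While of nat & cmd.         (* loop while r_x <> 0 *)

Record machine := Machine { reg : nat -> nat; mem : nat -> nat }.

Definition upd (f : nat -> nat) (x v : nat) : nat -> nat :=
  fun y => if y == x then v else f y.

Definition set_reg (M : machine) (x v : nat) : machine :=
  Machine (upd (reg M) x v) (mem M).

Definition set_mem (M : machine) (x v : nat) : machine :=
  Machine (reg M) (upd (mem M) x v).

(* exec p M t M' : started in M, p halts in M' after t steps. *)
Inductive exec : cmd -> machine -> nat -> machine -> Prop :=
| exec_skip M : exec Skip M 1 M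
| exec_const M x c : exec (Const x c) M 1 (set_reg M x c)
| exec_add M x y z :
    exec (Add x y z) M 1 (set_reg M x (reg M y + reg M z)%N)
| exec_sub M x y z :
    exec (Sub x y z) M 1 (set_reg M x (reg M y - reg M z)%N)
| exec_get M x y : exec (Get x y) M 1 (set_reg M x (mem M (reg M y)))
| exec_put M x y : exec (Put x y) M 1 (set_mem M (reg M x) (reg M y))
| exec_seq p q M t M' t' M'' :
    exec p M t M' -> exec q M' t' M'' -> exec (Seq p q) M (t + t')%N M''
| exec_if_true x p q M t M' :
    reg M x != 0%N -> exec p M t M' -> exec (If x p q) M t.+1 M'
| exec_if_false x p q M t M' :
    reg M x = 0%N -> exec q M t M' -> exec (If x p q) M t.+1 M'
| exec_while_true x p M t M' t' M'' :
    reg M x != 0%N -> exec p M t M' -> exec (While x p) M' t' M'' ->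
    exec (While x p) M (t + t').+1 M''
| exec_while_false x p M :
    reg M x = 0%N -> exec (While x p) M 1 M.

(* All registers start at 0; the input and the output are read from the
   memory, from address 0 on. *)
Definition computes (p : cmd) (input output : seq nat) (t : nat) : Prop :=
  exists t' M', [/\ (t' <= t)%N,
    exec p (Machine (fun=> 0%N) (nth 0%N input)) t' M' &
    forall i, (i < size output)%N -> mem M' i = nth 0%N output i].

(* Main.v *)
Require Import Defs.
From mathcomp Require Import all_boot all_order all_algebra all_fingroup.
From mathcomp Require Import cyclic.
From mathcomp Require Import complex reals exp.
From mathcomp Require Import zify ring lra.
Set Implicit Arguments.
Unset Strict Implicit.
Unset Printing Implicit Defensive.
Import Order.TTheory GRing.Theory Num.Theory.

(**
For a divisor k of n, a Hadamard test of T^k on an ancilla never shows 1 if k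
is in H, and shows 1 with probability (1 - Re <psi|T^k|psi>)/2 > eps/2 otherwise.
One circuit performs, one after the other and on the same copy, the tests of all
k = n / p^b with p^b a prime power dividing n: there are at most log2 n of
them, and as the T^k commute the outcome on each ancilla is distributed as if
its test were the only one.  Since k is in H iff p^b divides |H|, the answers
determine |H|, hence H, which is generated by n / |H|.  With a tests and
s = 12 a m copies, m being the integer part of 1 / eps, a union bound gives the
failure probability a (1 - eps/2)^s <= a / (1 + s eps/2) <= 1/3.

For k dividing n, the controlled T^k is the sequence of the controlled swaps
of the qubits j and j + k, for j = 0, ..., n - k - 1.
*)

(** * Symbolic execution of programs *)

(** Testing prime powers rather than all divisors keeps the number of tests at the number of prime
    factors of n counted with multiplicity, hence at most log2 n; each test costs at most n + 2
    gates, which gives the depth.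

    The post-processing has to know which prime power belongs to which ancilla. Instead of storing
    the list, both programs rerun the same trial division and differ only in what they do when a
    pair is recorded. The machine neither multiplies nor divides, so products and quotients are
    loops of additions and subtractions.

    The estimate (1 - eps/2)^s <= 1 / (1 + s eps/2) is far from sharp, but a failure probability of
    1/(3a) per test then needs s of order a / eps, and a is already of order log n.

    If eps > 1 then m = 0 and no copy is used. The promise then leaves only H = Z_n, and with no
    samples every test counts as quiet, which is the right answer. *)

Definition agrees (M : machine) (l w : seq nat) : Prop :=
  (forall i, i < size l -> reg M i = nth 0 l i) /\ Defs.mem M =1 nth 0 w.

(** Total correctness with a time bound. Through [agrees], registers beyond the list [l] are
    arbitrary, while the whole memory is prescribed, with zeros beyond [w]. *)
Definition run p l w t l' w' : Prop := forall M, agrees M l w ->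
  exists t' M', [/\ t' <= t, exec p M t' M' & agrees M' l' w'].

Lemma run_seq p q l w t l1 w1 t1 l2 w2 :
  run p l w t l1 w1 -> run q l1 w1 t1 l2 w2 -> run (Seq p q) l w (t + t1) l2 w2.
Proof.
move=> hp hq M /hp [t' [M' [let' e' /hq [t'' [M'' [let'' e'' s'']]]]]].
exists (t' + t''), M''; split=> //; first by rewrite leq_add.
exact: exec_seq e' e''.
Qed.

Lemma run_weaken p l w t l1 w1 t2 :
  run p l w t l1 w1 -> t <= t2 -> run p l w t2 l1 w1.
Proof.
move=> hp le M /hp [t' [M' [let' e' s']]]; exists t', M'; split=> //.
exact: leq_trans le.
Qed.

Lemma run_if_true x p q l w t l1 w1 : x < size l -> nth 0 l x != 0 ->
  run p l w t l1 w1 -> run (If x p q) l w t.+1 l1 w1.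
Proof.
move=> hx nz hp M sM; have [t' [M' [let' e' s']]] := hp M sM.
by exists t'.+1, M'; split=> //; apply: exec_if_true => //; rewrite sM.1.
Qed.

Lemma run_if_false x p q l w t l1 w1 : x < size l -> nth 0 l x = 0 ->
  run q l w t l1 w1 -> run (If x p q) l w t.+1 l1 w1.
Proof.
move=> hx nz hp M sM; have [t' [M' [let' e' s']]] := hp M sM.
by exists t'.+1, M'; split=> //; apply: exec_if_false => //; rewrite sM.1.
Qed.

(** The families [L] and [F], indexed by the number of completed iterations, serve as invariant. The
    induction peels off the first iteration, hence the shifted families; the extra unit in [B.+1]
    pays for the loop test. *)
Lemma run_while x p (L F : nat -> seq nat) B k :
  (forall i, i <= k -> x < size (L i)) ->
  (forall i, i < k -> nth 0 (L i) x != 0) -> nth 0 (L k) x = 0 ->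
  (forall i, i < k -> run p (L i) (F i) B (L i.+1) (F i.+1)) ->
  run (While x p) (L 0) (F 0) (k * B.+1).+1 (L k) (F k).
Proof.
elim: k L F => [|k IH] L F hs hnz hz hp.
  move=> M sM; exists 1, M; split=> //.
  by apply: exec_while_false; rewrite sM.1 ?hs.
move=> M sM; have [t' [M' [let' e' s']]] := hp 0 isT M sM.
have [||||t'' [M'' [let'' e'' s'']]] :=
   IH (fun i => L i.+1) (fun i => F i.+1) _ _ _ _ M' s' => //.
- by move=> i; apply: (hs i.+1).
- by move=> i; apply: (hnz i.+1).
- by move=> i; apply: (hp i.+1).
exists (t' + t'').+1, M''; split=> //.
  by move: let' let''; rewrite mulSn; lia.
by apply: exec_while_true e''; rewrite ?sM.1 ?hs ?hnz.
Qed.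

(** Loop-free code is verified by computation. [straight] excludes the branches and loops, on which
    [ev] and [cost] have default values, and keeps registers inside the list, so that [set_nth]
    never lengthens it. *)
Fixpoint straight p (s : nat) : bool :=
  match p with
  | Skip => true
  | Const x _ => x < s
  | Add x y z | Defs.Sub x y z => [&& x < s, y < s & z < s]
  | Get x y | Put x y => (x < s) && (y < s)
  | Seq p q => straight p s && straight q s
  | _ => false
  end.

Fixpoint ev p (s : seq nat * seq nat) : seq nat * seq nat :=
  match p with
  | Const x c => (set_nth 0 s.1 x c, s.2)
  | Add x y z => (set_nth 0 s.1 x (nth 0 s.1 y + nth 0 s.1 z), s.2)
  | Defs.Sub x y z => (set_nth 0 s.1 x (nth 0 s.1 y - nth 0 s.1 z), s.2)
  | Get x y => (set_nth 0 s.1 x (nth 0 s.2 (nth 0 s.1 y)), s.2)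
  | Put x y => (s.1, set_nth 0 s.2 (nth 0 s.1 x) (nth 0 s.1 y))
  | Seq p q => ev q (ev p s)
  | _ => s
  end.

Fixpoint cost p : nat := if p is Seq p q then cost p + cost q else 1.

Lemma agrees_set_reg M l w x v : x < size l -> agrees M l w ->
  agrees (set_reg M x v) (set_nth 0 l x v) w.
Proof.
move=> hx [hl hw]; split=> // i; rewrite size_set_nth (maxn_idPr hx) => hi.
by rewrite nth_set_nth /= /upd; case: eqP => // _; rewrite hl.
Qed.

Lemma size_ev p s : straight p (size s.1) -> size (ev p s).1 = size s.1.
Proof.
elim: p s => //= [x c|x y z|x y z|x y|p IHp q IHq] s.
- by move=> hx; rewrite size_set_nth (maxn_idPr hx).
- by case/and3P=> hx _ _; rewrite size_set_nth (maxn_idPr hx).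
- by case/and3P=> hx _ _; rewrite size_set_nth (maxn_idPr hx).
- by case/andP=> hx _; rewrite size_set_nth (maxn_idPr hx).
by case/andP=> hp hq; rewrite IHq ?IHp.
Qed.

Lemma run_straight p l w : straight p (size l) ->
  run p l w (cost p) (ev p (l, w)).1 (ev p (l, w)).2.
Proof.
elim: p l w => //= [|x c|x y z|x y z|x y|x y|p IHp q IHq] l w.
- by move=> _ M sM; exists 1, M; split=> //; constructor.
- move=> hx M sM; exists 1, (set_reg M x c); split=> //; first by constructor.
  exact: agrees_set_reg.
- case/and3P=> hx hy hz M sM.
  exists 1, (set_reg M x (reg M y + reg M z)); split=> //; first by constructor.
  by rewrite -!sM.1 //; apply: agrees_set_reg.
- case/and3P=> hx hy hz M sM.
  exists 1, (set_reg M x (reg M y - reg M z)); split=> //; first by constructor.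
  by rewrite -!sM.1 //; apply: agrees_set_reg.
- case/andP=> hx hy M sM.
  exists 1, (set_reg M x (Defs.mem M (reg M y))); split=> //; first by constructor.
  by rewrite -!sM.1 // -sM.2; apply: agrees_set_reg.
- case/andP=> hx hy M sM.
  exists 1, (set_mem M (reg M x) (reg M y)); split=> //; first by constructor.
  split=> [i hi|i]; first exact: sM.1.
  by rewrite nth_set_nth /= /upd !sM.1 // -sM.2.
case/andP=> hp hq; rewrite [ev p _]surjective_pairing.
by apply: run_seq (IHp _ _ hp) (IHq _ _ _); rewrite size_ev.
Qed.

Lemma run_straight_eq p l w l' w' t : straight p (size l) -> cost p <= t ->
  ev p (l, w) = (l', w') -> run p l w t l' w'.
Proof.
move=> hp ht e; have := @run_straight p l w hp; rewrite e => h.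
exact: run_weaken h ht.
Qed.

(** * Trial division *)

Infix ";;" := Seq (at level 60, right associativity).

Definition clear_div := Const 10 0 ;; Const 11 0 ;; Const 12 0.

(* r_10 := r_x mod r_7 and r_11 := r_x div r_7. *)
Definition divide x : cmd :=
  (Add 10 x 15 ;; Const 11 0 ;; Add 12 10 2 ;; Defs.Sub 12 12 7) ;;
  While 12 (Defs.Sub 10 10 7 ;; Add 11 11 2 ;; Add 12 10 2 ;; Defs.Sub 12 12 7).

(* Registers 2 and 15 hold the constants 1 and 0; registers 0 and 1 the inputs n
   and m; registers 6, 7, 8 and 9 the variables r, p, Q of the trial division and
   its loop counter. *)
Definition lay (a0 a1 a3 a4 a5 a6 a7 a8 a9 a10 a11 a12 a13 a14 a16 a17 : nat) :=
  [:: a0; a1; 1; a3; a4; a5; a6; a7; a8; a9; a10; a11; a12; a13; a14; 0; a16;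
      a17].

Lemma run_divide x a0 a1 a3 a4 a5 a6 p a8 a9 b10 b11 b12 a13 a14 a16 a17 w X :
  x \in [:: 3; 6; 8] -> 0 < p ->
  let l u v t := lay a0 a1 a3 a4 a5 a6 p a8 a9 u v t a13 a14 a16 a17 in
  X = nth 0 (l b10 b11 b12) x ->
  run (divide x) (l b10 b11 b12) w (5 * X + 5) (l (X %% p) (X %/ p) 0) w.
Proof.
move=> hx p0 l hX.
(* Register 12 holds remainder + 1 - p, truncated: it is zero exactly when the remainder is below
   p. *)
pose L i := l (X - i * p) i ((X - i * p).+1 - p).
have h1 : run (Add 10 x 15 ;; Const 11 0 ;; Add 12 10 2 ;; Defs.Sub 12 12 7)
    (l b10 b11 b12) w 4 (L 0) w.
  move: hx; rewrite !inE => /or3P[] /eqP ex; move: hX; rewrite ex /= => hX;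
   (apply: run_straight_eq => //=; rewrite /L /l /lay; congr pair;
    rewrite hX addn0 mul0n subn0 addn1 //).
have h2 : run (While 12 (Defs.Sub 10 10 7 ;; Add 11 11 2 ;; Add 12 10 2 ;;
     Defs.Sub 12 12 7)) (L 0) w (X %/ p * 5).+1 (L (X %/ p)) w.
  apply: (@run_while _ _ L (fun=> w)) => //.
  - move=> i hi; have /= : i.+1 * p <= X.
      by apply: leq_trans (leq_trunc_div X p); rewrite leq_mul2r hi orbT.
    by rewrite mulSn; lia.
  - rewrite /=; have := divn_eq X p; have := ltn_pmod X p0; lia.
  move=> i hi; apply: run_straight_eq => //=.
  by rewrite /L /l /lay addn1 addn1 -subnDA mulSnr.
have e : L (X %/ p) = l (X %% p) (X %/ p) 0.
  have := divn_eq X p; have := ltn_pmod X p0 => h e.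
  rewrite /L; congr l; lia.
rewrite e in h2.
apply: run_weaken (run_seq h1 h2) _.
by have := leq_div X p; lia.
Qed.

(** [emit] is the hook called for each recorded pair: the generator writes the code of a test there,
    the post-processing evaluates the outcomes of that test. *)
Definition find_divisor_step (emit : cmd) : cmd :=
  divide 6 ;;
  If 10 (Add 7 7 2 ;; Add 8 0 15 ;; clear_div)
    ((Add 6 11 15) ;; divide 8 ;; (Add 8 11 15 ;; clear_div) ;; emit) ;;
  Defs.Sub 9 9 2.

Definition trial_division (emit : cmd) : cmd := While 9 (find_divisor_step emit).

(* Trial division of r by p, with n / Q the power of p that has been removed;
   a pair (p, Q) is recorded whenever p is removed from r. *)
Definition fstep n (s : seq (nat * nat) * (nat * nat * nat)) :=
  let: (T, (r, p, Q)) := s in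
  if p %| r then (rcons T (p, Q %/ p), (r %/ p, p, Q %/ p))
  else (T, (r, p.+1, n)).

Definition fstate n t := iter t (fstep n) ([::], (n, 2, n)).

(** A step either increments p or records a pair, and at most n pairs are recorded, so 2n steps
    bring p beyond every candidate divisor. Once r = 1, further steps only increase p. *)
Definition tests n := (fstate n n.*2).1.

Lemma fstate_bounds n t : let: (T, (r, p, Q)) := fstate n t in
  [/\ 1 < p, Q <= n & r <= n].
Proof.
rewrite /fstate; elim: t => [|t] //=.
case: (iter t _ _) => T [[r p] Q] /= [p2 Qn rn].
by case: ifP => _; split; rewrite ?(leq_trans (leq_div _ _)) // leqW.
Qed.

Section Loop.
Variables (n m B : nat) (emit : cmd).
Variables (x3 x4 x5 x16 : seq (nat * nat) -> nat) (W : seq (nat * nat) -> seq nat).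

Let st (T : seq (nat * nat)) r p Q c :=
  lay n m (x3 T) (x4 T) (x5 T) r p Q c 0 0 0 0 0 (x16 T) 0.

Hypothesis run_emit : forall T r p Q c, 1 < p -> Q <= n ->
  let T' := rcons T (p, Q) in
  run emit (st T r p Q c) (W T) B (st T' r p Q c) (W T').

Lemma run_find_divisor_step T r p Q c : 1 < p -> Q <= n -> r <= n ->
  let: (T', (r', p', Q')) := fstep n (T, (r, p, Q)) in
  run (find_divisor_step emit) (st T r p Q c.+1) (W T)
    (10 * n + B + 30) (st T' r' p' Q' c) (W T').
Proof.
move=> p2 Qn rn; have p0 : 0 < p by apply: leq_trans p2.
have h1 := @run_divide 6 n m (x3 T) (x4 T) (x5 T) r p Q c.+1 0 0 0 0 0 (x16 T)
  0 (W T) r isT p0 erefl.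
rewrite /= /dvdn; case: eqP => [r0|/eqP r0].
  rewrite r0 in h1.
  have h2 := @run_divide 8 n m (x3 T) (x4 T) (x5 T) (r %/ p) p Q c.+1 0
    (r %/ p) 0 0 0 (x16 T) 0 (W T) Q isT p0 erefl.
  have {}Qn' := leq_trans (leq_div Q p) Qn.
  have h3 := @run_emit T (r %/ p) p (Q %/ p) c.+1 p2 Qn'.
  have h1' : run (Add 6 11 15) (lay n m (x3 T) (x4 T) (x5 T) r p Q c.+1 0
      (r %/ p) 0 0 0 (x16 T) 0) (W T) 1 (lay n m (x3 T) (x4 T) (x5 T) (r %/ p)
      p Q c.+1 0 (r %/ p) 0 0 0 (x16 T) 0) (W T).
    by apply: run_straight_eq => //=; rewrite /lay addn0.
  have h2' : run (Add 8 11 15 ;; clear_div) (lay n m (x3 T) (x4 T) (x5 T)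
      (r %/ p) p Q c.+1 (Q %% p) (Q %/ p) 0 0 0 (x16 T) 0) (W T) 4
      (st T (r %/ p) p (Q %/ p) c.+1) (W T).
    by apply: run_straight_eq => //=; rewrite /st /lay addn0.
  apply: run_weaken.
    apply: run_seq h1 _; apply: run_seq.
      apply: run_if_false => //.
      exact: run_seq h1' (run_seq h2 (run_seq h2' h3)).
    apply: (run_straight_eq (t := 1)) => //=.
    by rewrite /st /lay subn1.
  lia.
apply: run_weaken.
  apply: run_seq h1 _; apply: run_seq.
    apply: run_if_true => //; apply: (run_straight_eq (t := 5)) => //.
  apply: (run_straight_eq (t := 1)) => //=.
  by rewrite /st /lay subn1 addn0 addn1.
lia.
Qed.

Lemma run_trial_division :
  let: (T, (r, p, Q)) := fstate n n.*2 in
  run (trial_division emit) (st [::] n 2 n n.*2) (W [::])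
    (n.*2 * (10 * n + B + 31)).+1 (st T r p Q 0) (W T).
Proof.
pose L t := let: (T, (r, p, Q)) := fstate n t in st T r p Q (n.*2 - t).
pose F t := W (fstate n t).1.
have := @run_while 9 (find_divisor_step emit) L F (10 * n + B + 30) n.*2.
have L0 : L 0 = st [::] n 2 n n.*2 by rewrite /L /= subn0.
have Lk : L n.*2 = let: (T, (r, p, Q)) := fstate n n.*2 in st T r p Q 0.
  by rewrite /L subnn.
rewrite L0 Lk -addnS /F; case E : (fstate n n.*2) => [T [[r p] Q]] /=.
apply => //.
- by move=> i _; rewrite /L; case: (fstate n i) => T' [[r' p'] Q'].
- move=> i hi; rewrite /L; case: (fstate n i) => T' [[r' p'] Q'] /=; lia.
move=> i hi; have := fstate_bounds n i; rewrite /L /F /fstate iterS.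
case: (iter i _ _) => T' [[r' p'] Q'] [hp hQ hr].
have := run_find_divisor_step T' (n.*2 - i.+1) hp hQ hr.
have -> : n.*2 - i = (n.*2 - i.+1).+1 by lia.
by case: (fstep _ _) => T'' [[r'' p''] Q''].
Qed.

End Loop.

(** * The two programs *)

Lemma set_nth_size (T : Type) (x0 v : T) w : set_nth x0 w (size w) v = rcons w v.
Proof. by elim: w => //= y w ->. Qed.

(* Appends the registers xs to the output; r_3 is the output pointer. *)
Definition outs (xs : seq nat) : cmd :=
  foldr (fun x p => (Put 3 x ;; Add 3 3 2) ;; p) Skip xs.

Lemma run_outs xs l w : size l = 18 -> all (fun x => (x < 18) && (x != 3)) xs ->
  nth 0 l 2 = 1 -> nth 0 l 3 = size w ->
  run (outs xs) l w (2 * size xs + 1) (set_nth 0 l 3 (size w + size xs))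
    (w ++ [seq nth 0 l x | x <- xs]).
Proof.
elim: xs l w => [|x xs IH] l w hl /=.
  move=> _ _ h3; apply: run_straight_eq => //=; rewrite addn0 cats0.
  congr pair; apply: (@eq_from_nth _ 0).
    by rewrite size_set_nth hl.
  by move=> i hi; rewrite nth_set_nth /=; case: eqP => // ->.
case/andP=> /andP[hx x3] hxs h2 h3.
set l1 := set_nth 0 l 3 (size w + 1); set w1 := rcons w (nth 0 l x).
have hl1 : size l1 = 18 by rewrite size_set_nth hl.
have h1 : run (Put 3 x ;; Add 3 3 2) l w 2 l1 w1.
  apply: run_straight_eq; rewrite //= ?hl ?hx //= h2 h3; congr pair.
  exact: set_nth_size.
have := IH l1 w1 hl1 hxs.
rewrite /l1 nth_set_nth /= h2 nth_set_nth /= size_rcons addn1 => /(_ erefl erefl).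
rewrite set_set_nth /= /w1 cat_rcons => h.
have e : [seq nth 0 (set_nth 0 l 3 (size w).+1) y | y <- xs] =
    [seq nth 0 l y | y <- xs].
  apply/eq_in_map => y hy; rewrite nth_set_nth /=.
  by case: eqP => // y3; move/allP/(_ y hy): hxs; rewrite y3 andbF.
rewrite e addSnnS in h; rewrite /l1 addn1 in h1.
by apply: run_weaken (run_seq h1 h) _; lia.
Qed.

(* Every layer consists of one gate; gate 0 is the Hadamard gate, gate 1 the
   controlled swap. *)
Definition test_code n z k : seq nat :=
  [:: 1; 0; z] ++ flatten [seq [:: 1; 1; z; j; j + k] | j <- iota 0 (n - k)]
  ++ [:: 1; 0; z].

Definition tests_code n (T : seq (nat * nat)) : seq nat :=
  flatten [seq test_code n (n + i) (nth (0, 0) T i).2 | i <- iota 0 (size T)].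

Definition gates_count n (T : seq (nat * nat)) : nat :=
  sumn [seq n - x.2 + 2 | x <- T].

Lemma tests_code_rcons n T x :
  tests_code n (rcons T x) = tests_code n T ++ test_code n (n + size T) x.2.
Proof.
rewrite /tests_code size_rcons -addn1 iotaD map_cat flatten_cat /= cats0.
rewrite nth_rcons ltnn eqxx; congr (flatten _ ++ _).
by apply/eq_in_map => i; rewrite mem_iota nth_rcons => /andP[_ ->].
Qed.

Lemma gates_count_rcons n T x :
  gates_count n (rcons T x) = gates_count n T + (n - x.2) + 2.
Proof. by rewrite /gates_count map_rcons sumn_rcons addnA. Qed.

(** Registers 4 and 5 count gates and tests. Registers 12, 13, 17 and 14 hold the number of swaps
    left, the ancilla n + i, and the two swapped positions j and j + k. Scratch registers are reset
    to 0, as the loop invariant demands. *)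
Definition emit_test : cmd :=
  (Add 13 0 5 ;; Defs.Sub 12 0 8 ;; Add 14 8 15) ;; outs [:: 2; 15; 13] ;;
  While 12 (outs [:: 2; 2; 13; 17; 14] ;;
            (Add 17 17 2 ;; Add 14 14 2 ;; Add 4 4 2 ;; Defs.Sub 12 12 2)) ;;
  outs [:: 2; 15; 13] ;;
  (Add 4 4 2 ;; Add 4 4 2 ;; Add 5 5 2 ;;
   Const 13 0 ;; Const 14 0 ;; Const 17 0).

Lemma run_emit_test n m T r p Q c : 1 < p -> Q <= n ->
  let w0 := [:: n; m; 0] in
  let st T := lay n m (size (w0 ++ tests_code n T)) (gates_count n T) (size T)
    r p Q c 0 0 0 0 0 0 0 in
  let T' := rcons T (p, Q) in
  run emit_test (st T) (w0 ++ tests_code n T) (16 * n + 30)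
    (st T') (w0 ++ tests_code n T').
Proof.
move=> p2 Qn w0 st T'; set w := w0 ++ _.
set G := gates_count n T; set a := size T; set z := n + a.
pose l s G t j q := lay n m s G a r p Q c 0 0 t z q 0 j.
pose code1 := w ++ [:: 1; 0; z].
pose F i := code1 ++ flatten [seq [:: 1; 1; z; j; j + Q] | j <- iota 0 i].
pose L i := l (size (F i)) (G + i) (n - Q - i) i (i + Q).
have h0 : run (Add 13 0 5 ;; Defs.Sub 12 0 8 ;; Add 14 8 15) (st T) w 3
   (l (size w) G (n - Q) 0 Q) w.
  by apply: run_straight_eq => //=; rewrite /l /lay addn0.
have h1 : run (outs [:: 2; 15; 13]) (l (size w) G (n - Q) 0 Q) w 7 (L 0) (F 0).
  have := @run_outs [:: 2; 15; 13] (l (size w) G (n - Q) 0 Q) w erefl isT erefl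
    erefl.
  by rewrite /L /F /= cats0 /code1 size_cat addn0 subn0.
have h2 : run (While 12 (outs [:: 2; 2; 13; 17; 14] ;;
      (Add 17 17 2 ;; Add 14 14 2 ;; Add 4 4 2 ;; Defs.Sub 12 12 2)))
    (L 0) (F 0) ((n - Q) * 16).+1 (L (n - Q)) (F (n - Q)).
  apply: run_while => // [i hi||i hi]; first by rewrite /= ; lia.
    by rewrite /= subnn.
  have g := @run_outs [:: 2; 2; 13; 17; 14] (L i) (F i) erefl isT erefl erefl.
  have e : F i ++ [:: 1; 1; z; i; i + Q] = F i.+1.
    by rewrite /F -[i.+1]addn1 iotaD map_cat flatten_cat /= catA.
  rewrite [_ ++ _]e in g.
  have es : size (F i.+1) = size (F i) + 5 by rewrite -e size_cat.
  apply: (run_seq (t := 11) (t1 := 4)) g _; apply: run_straight_eq => //.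
  rewrite /L es /l /lay /=; congr pair.
  by do !congr cons; lia.
have h3 := @run_outs [:: 2; 15; 13] (L (n - Q)) (F (n - Q)) erefl isT erefl erefl.
have eF : F (n - Q) ++ [:: 1; 0; z] = w0 ++ tests_code n T'.
  by rewrite tests_code_rcons /test_code !catA.
have es : size (w0 ++ tests_code n T') = size (F (n - Q)) + 3.
  by rewrite -eF size_cat.
rewrite [_ ++ _]eF in h3.
apply: run_weaken.
  apply: run_seq h0 _; apply: run_seq h1 _; apply: run_seq h2 _.
  apply: run_seq h3 _; apply: (run_straight_eq (t := 6)) => //.
  rewrite /st es gates_count_rcons size_rcons /L /l /lay /= subnn.
  by congr pair; do !congr cons; lia.
by rewrite /=; lia.
Qed.

(** Three cells are reserved for s, a and the number of layers, known only at the end, so the code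
    starts at address 3. The product 12 a is formed as 4 a + 8 a and then added up m times. *)
Definition gen_prog : cmd :=
  (Get 0 15 ;; Const 2 1 ;; Get 1 2 ;; Const 3 3 ;; Add 6 0 15 ;; Const 7 2 ;;
   Add 8 0 15 ;; Add 9 0 0 ;; Put 7 15) ;;
  trial_division emit_test ;;
  (Add 10 5 5 ;; Add 10 10 10 ;; Add 11 10 10 ;; Add 10 10 11 ;; Add 12 1 15) ;;
  While 12 (Add 13 13 10 ;; Defs.Sub 12 12 2) ;;
  (Put 15 13 ;; Put 2 5 ;; Const 14 2 ;; Put 14 4).

Lemma computes_gen n m : let T := tests n in
  computes gen_prog [:: n; m]
    ([:: 12 * size T * m; size T; gates_count n T] ++ tests_code n T)
    (n.*2 * (26 * n + 61) + 3 * m + 25).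
Proof.
move=> T; pose w0 := [:: n; m; 0].
have h0 : run (Get 0 15 ;; Const 2 1 ;; Get 1 2 ;; Const 3 3 ;; Add 6 0 15 ;;
    Const 7 2 ;; Add 8 0 15 ;; Add 9 0 0 ;; Put 7 15) (nseq 18 0) [:: n; m] 9
   (lay n m 3 0 0 n 2 n n.*2 0 0 0 0 0 0 0) (w0 ++ tests_code n [::]).
  apply: run_straight_eq => //=; rewrite /lay !addn0 addnn //.
have h1 := @run_trial_division n m (16 * n + 30) emit_test
  (fun T => size (w0 ++ tests_code n T)) (fun T => gates_count n T)
  (fun T => size T) (fun=> 0) (fun T => w0 ++ tests_code n T)
  (fun T r p Q c => @run_emit_test n m T r p Q c).
have : T = (fstate n n.*2).1 by [].
case: (fstate n n.*2) h1 => T0 [[r p] Q] /= h1 eT; rewrite -{}eT in h1 => {T0}.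
pose L i := lay n m (size (w0 ++ tests_code n T)) (gates_count n T) (size T)
  r p Q 0 (12 * size T) (8 * size T) (m - i) (12 * size T * i) 0 0 0.
have h2 : run (Add 10 5 5 ;; Add 10 10 10 ;; Add 11 10 10 ;; Add 10 10 11 ;;
    Add 12 1 15) (lay n m (size (w0 ++ tests_code n T)) (gates_count n T)
      (size T) r p Q 0 0 0 0 0 0 0 0) (w0 ++ tests_code n T) 5
    (L 0) (w0 ++ tests_code n T).
  apply: run_straight_eq => //=; rewrite /L /lay /=; congr pair.
  by do !congr cons; lia.
have h3 : run (While 12 (Add 13 13 10 ;; Defs.Sub 12 12 2)) (L 0)
    (w0 ++ tests_code n T) (m * 3).+1 (L m) (w0 ++ tests_code n T).
  apply: (@run_while _ _ L (fun=> w0 ++ tests_code n T)) => // [i hi||i hi].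
  - by rewrite /=; lia.
  - by rewrite /= subnn.
  apply: run_straight_eq => //=; rewrite /L /lay; congr pair.
  by do !congr cons; lia.
have h4 : run (Put 15 13 ;; Put 2 5 ;; Const 14 2 ;; Put 14 4) (L m)
    (w0 ++ tests_code n T) 4
    (set_nth 0 (L m) 14 2)
    ([:: 12 * size T * m; size T; gates_count n T] ++ tests_code n T).
  exact: run_straight_eq.
have [] := run_seq h0 (run_seq h1 (run_seq h2 (run_seq h3 h4)))
  (M := Machine (fun=> 0) (nth 0 [:: n; m])).
  by split=> // i; rewrite nth_nseq if_same.
move=> t' [M' [ht e [_ sM]]]; exists t', M'; split=> //.
by apply: leq_trans ht _; rewrite /=; lia.
Qed.

(* 4 + n + i + j * N is the address of the bit of ancilla i in sample j. *)
Definition silent (W : seq nat) n N s i : bool :=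
  \sum_(j < s) nth 0 W (4 + n + i + j * N) == 0.

(* quiet i means that no sample shows a 1 on the ancilla of test i. *)
Definition decode n (quiet : pred nat) (T : seq (nat * nat)) : nat :=
  foldl (fun g i => if quiet i then g %/ (nth (0, 0) T i).1 else g) n
    (iota 0 (size T)).

Lemma decode_rcons n quiet T x : decode n quiet (rcons T x) =
  let g := decode n quiet T in if quiet (size T) then g %/ x.1 else g.
Proof.
rewrite /decode size_rcons -addn1 iotaD foldl_cat /= add0n nth_rcons ltnn eqxx.
suff -> : foldl (fun g i => if quiet i then g %/ (nth (0, 0) (rcons T x) i).1
    else g) n (iota 0 (size T)) = decode n quiet T by [].
rewrite /decode; have : all (fun i => i < size T) (iota 0 (size T)).
  by apply/allP => i; rewrite mem_iota.
elim: (iota _ _) n => //= i l IH g /andP[hi hl].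
by rewrite nth_rcons hi IH.
Qed.

Lemma leq_decode n quiet T : decode n quiet T <= n.
Proof.
elim/last_ind: T => [|T x IH]; first exact: leqnn.
by rewrite decode_rcons /=; case: ifP => _ //; apply: leq_trans (leq_div _ _) IH.
Qed.

(** Register 13 adds up the bits of one ancilla over all samples, with stride N in memory. If the
    sum is 0, the guess in register 3 is divided by the prime that trial division keeps in register
    7. *)
Definition check_test : cmd :=
  (Const 14 4 ;; Add 14 14 0 ;; Add 14 14 5 ;; Add 12 16 15) ;;
  While 12 (Get 10 14 ;; Add 13 13 10 ;; Add 14 14 4 ;; Const 10 0 ;;
            Defs.Sub 12 12 2) ;;
  If 13 Skip (divide 3 ;; (Add 3 11 15 ;; clear_div)) ;;
  (Const 13 0 ;; Const 14 0 ;; Add 5 5 2).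

Lemma run_check_test n m s N W T r p Q c : 1 < p -> Q <= n ->
  let st T := lay n m (decode n (silent W n N s) T) N (size T)
    r p Q c 0 0 0 0 0 s 0 in
  run check_test (st T) W (6 * s + 5 * n + 30) (st (rcons T (p, Q))) W.
Proof.
move=> p2 Qn st; set q := silent W n N s; set g := decode n q T.
set i := size T; have p0 : 0 < p by apply: leq_trans p2.
pose l g u v t o a := lay n m g N i r p Q c u v t o a s 0.
pose L k := l g 0 0 (s - k) (\sum_(j < k) nth 0 W (4 + n + i + j * N))
  (4 + n + i + k * N).
have h0 : run (Const 14 4 ;; Add 14 14 0 ;; Add 14 14 5 ;; Add 12 16 15) (st T) W
    4 (L 0) W.
  apply: run_straight_eq => //=; rewrite /L /l /lay big_ord0; congr pair.
  by do !congr cons; lia.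
have h1 : run (While 12 (Get 10 14 ;; Add 13 13 10 ;; Add 14 14 4 ;;
    Const 10 0 ;; Defs.Sub 12 12 2)) (L 0) W (s * 6).+1 (L s) W.
  apply: (@run_while _ _ L (fun=> W)) => // [k hk||k hk].
  - by rewrite /=; lia.
  - by rewrite /= subnn.
  apply: run_straight_eq => //; rewrite /L /l /lay big_ord_recr /=; congr pair.
  by do !congr cons; lia.
have h2 : run (If 13 Skip (divide 3 ;; (Add 3 11 15 ;; clear_div))) (L s) W
    (5 * n + 12) (l (if q i then g %/ p else g) 0 0 0 (nth 0 (L s) 13)
                   (nth 0 (L s) 14)) W.
  case: (eqVneq (nth 0 (L s) 13) 0) => [o0|o0].
    have -> : q i by rewrite /q /silent; apply/eqP.
    have h := @run_divide 3 n m g N i r p Q c 0 0 (s - s) (nth 0 (L s) 13)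
      (nth 0 (L s) 14) s 0 W g isT p0 erefl.
    apply: run_weaken.
      apply: run_if_false => //; apply: run_seq h _.
      apply: (run_straight_eq (t := 4)) => //.
      by rewrite /l /lay /= addn0.
    by have := leq_decode n q T; rewrite -/g; lia.
  have -> : q i = false by apply/negbTE.
  apply: run_weaken.
    apply: run_if_true => //; apply: (run_straight_eq (t := 1)) => //.
    by rewrite /L /l /lay /= subnn.
  lia.
apply: run_weaken.
  apply: run_seq h0 _; apply: run_seq h1 _; apply: run_seq h2 _.
  apply: (run_straight_eq (t := 3)) => //.
  by rewrite /st decode_rcons size_rcons /l /lay /= addn1.
lia.
Qed.

Definition post_prog : cmd :=
  (Get 0 15 ;; Const 2 1 ;; Get 1 2 ;; Const 10 2 ;; Get 16 10 ;; Const 10 3 ;;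
   Get 4 10 ;; Add 4 0 4 ;; Const 10 0 ;; Add 3 0 15 ;; Add 6 0 15 ;;
   Const 7 2 ;; Add 8 0 15 ;; Add 9 0 0) ;;
  trial_division check_test ;;
  Put 15 3.

Lemma computes_post n m s a D : let W := [:: n; m; s; a] ++ D in
  computes post_prog W [:: decode n (silent W n (n + a) s) (tests n)]
    (n.*2 * (15 * n + 6 * s + 61) + 20).
Proof.
move=> W; pose q := silent W n (n + a) s.
have h0 : run (Get 0 15 ;; Const 2 1 ;; Get 1 2 ;; Const 10 2 ;; Get 16 10 ;;
    Const 10 3 ;; Get 4 10 ;; Add 4 0 4 ;; Const 10 0 ;; Add 3 0 15 ;;
    Add 6 0 15 ;; Const 7 2 ;; Add 8 0 15 ;; Add 9 0 0) (nseq 18 0) W 14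
   (lay n m n (n + a) 0 n 2 n n.*2 0 0 0 0 0 s 0) W.
  apply: run_straight_eq => //=; rewrite /lay !addn0 addnn //.
have h1 := @run_trial_division n m (6 * s + 5 * n + 30) check_test
  (fun T => decode n q T) (fun=> n + a)
  (fun T => size T) (fun=> s) (fun=> W)
  (fun T r p Q c => @run_check_test n m s (n + a) W T r p Q c).
have : tests n = (fstate n n.*2).1 by [].
case: (fstate n n.*2) h1 => T0 [[r p] Q] /= h1 eT; rewrite -{}eT in h1 => {T0}.
set T := tests n in h1 *.
have h2 : run (Put 15 3)
   (lay n m (decode n q T) (n + a) (size T) r p Q 0 0 0 0 0 0 s 0) W 1
   (lay n m (decode n q T) (n + a) (size T) r p Q 0 0 0 0 0 0 s 0)
   (decode n q T :: behead W).
  exact: run_straight_eq.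
have [] := run_seq h0 (run_seq h1 h2) (M := Machine (fun=> 0) (nth 0 W)).
  by split=> // i; rewrite nth_nseq if_same.
move=> t' [M' [ht e [_ sM]]]; exists t', M'; split=> // [|[|//] _].
  by apply: leq_trans ht _; lia.
exact: sM.
Qed.

(** * Arithmetic of trial division *)

Lemma gcdnM_coprime h a b : coprime a b -> gcdn h (a * b) = gcdn h a * gcdn h b.
Proof.
move=> cab; apply/eqP; rewrite eqn_dvd; apply/andP; split.
  rewrite muln_gcdl !muln_gcdr !dvdn_gcd.
  have [dh dab] := (dvdn_gcdl h (a * b), dvdn_gcdr h (a * b)).
  by rewrite dab (dvdn_mulr _ dh) (dvdn_mulr _ dh) (dvdn_mull _ dh).
rewrite dvdn_gcd dvdn_mul ?dvdn_gcdr // Gauss_dvd ?dvdn_gcdl //.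
apply: coprime_dvdl (dvdn_gcdr _ _) _; exact: coprime_dvdr (dvdn_gcdr _ _) cab.
Qed.

(** With h = |H|, this is the contribution of one answer: a quiet test reveals one more factor p of
    |H|. *)
Lemma gcdn_pfactorS p a h : prime p ->
  gcdn h (p ^ a.+1) = if p ^ a.+1 %| h then p * gcdn h (p ^ a) else gcdn h (p ^ a).
Proof.
move=> pp; case: ifP => [dv|ndv].
  rewrite (gcdn_idPr dv) (gcdn_idPr _) ?expnS //.
  by apply: dvdn_trans dv; rewrite dvdn_exp2l.
have /(dvdn_pfactor _ _ pp)[b ba eb] := dvdn_gcdr h (p ^ a.+1).
have {}ba : b <= a.
  rewrite -ltnS ltn_neqAle ba andbT; apply: contraFneq ndv => e.
  by rewrite -e -eb dvdn_gcdl.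
apply/eqP; rewrite eqn_dvd !dvdn_gcd !dvdn_gcdl /=; apply/andP; split.
  by rewrite eb dvdn_exp2l.
by apply: dvdn_trans (dvdn_gcdr _ _) _; rewrite dvdn_exp2l.
Qed.

Section TrialDivision.
Variable n : nat.
Hypothesis n0 : 0 < n.

(** Here e will be n / r, the part of n already divided out: [w] collects the primes below p, and
    p^a is what the current prime has contributed. *)
Definition smooth_part (p Q e : nat) : Prop := exists w a,
  [/\ e = p ^ a * w, Q * p ^ a = n & forall q, prime q -> q %| w -> q < p].

(** The bound with 2 ^ size T limits the number of tests, the next two relations force r = 1 after
    2n steps. In the last clause, [decode] has removed from n exactly the part of h visible in n /
    r; at r = 1 this is all of h. *)
Definition trial_inv t (s : seq (nat * nat) * (nat * nat * nat)) : Prop :=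
  let: (T, (r, p, Q)) := s in
  [/\ [/\ 1 < p, 0 < r, r %| n & forall d, 1 < d -> d %| r -> p <= d],
      smooth_part p Q (n %/ r),
      [/\ 2 ^ size T * r <= n, t + 2 = p + size T & size T + r <= n] &
      (forall i, i < size T ->
         let k := (nth (0, 0) T i).2 in [/\ 0 < k, k %| n & k < n]) /\
      forall h quiet, h %| n ->
        (forall i, i < size T ->
           quiet i = (n %/ (nth (0, 0) T i).2 %| h)) ->
        decode n quiet T * gcdn h (n %/ r) = n].

Lemma trial_inv_step t s : trial_inv t s -> trial_inv t.+1 (fstep n s).
Proof.
case: s => T [[r p] Q] [[p2 r0 rn small] [w [a [ew Qa wsm]]] [h2 ht hT] [hk hd]].
have p0 : 0 < p by apply: leq_trans p2.
rewrite /fstep; case: ifP => pr; last first.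
  split=> //.
  - split=> //.
    move=> d d1 dr; rewrite ltn_neqAle small // andbT.
    by apply: contraFneq pr => ->.
  (* Moving on to p + 1 puts everything removed so far into [w] and restarts the power at exponent
     0, which is why Q is reset to n. *)
  - exists (n %/ r), 0; rewrite expn0 mul1n muln1; split=> // q qq.
    rewrite ew Euclid_dvdM // => /orP[|/(wsm q qq)]; last exact: ltnW.
    by rewrite Euclid_dvdX // => /andP[/(dvdn_leq p0)].
  - by split=> //; lia.
have pp : prime p.
  have hr : pdiv p %| r by apply: dvdn_trans (pdiv_dvd p) pr.
  have := small _ (prime_gt1 (pdiv_prime p2)) hr.
  have := dvdn_leq p0 (pdiv_dvd p) => le1 le2.
  have <- : pdiv p = p by apply/eqP; rewrite eqn_leq le1.
  exact: pdiv_prime.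
have cpw b : coprime (p ^ b) w.
  apply: coprimeXl; rewrite prime_coprime //.
  by apply/negP => /(wsm p pp); rewrite ltnn.
have rp := divnK pr.
have rp0 : 0 < r %/ p by rewrite divn_gt0 // dvdn_leq.
have nr := divnK rn.
have er : n %/ (r %/ p) = p ^ a.+1 * w.
  have e : n = r %/ p * (p * (n %/ r)) by rewrite mulnA rp mulnC nr.
  by rewrite {1}e mulKn // ew mulnA -expnS.
have Qr : Q = r * w.
  apply/eqP; rewrite -(eqn_pmul2r (m := p ^ a)) ?expn_gt0 ?p0 // Qa -nr ew.
  by rewrite -mulnA mulnC [w * _]mulnC.
have eQ : Q %/ p * p ^ a.+1 = n.
  by rewrite expnS mulnA divnK ?Qr ?dvdn_mulr // -Qr.
have Q0 : 0 < Q %/ p by move: n0; rewrite -{1}eQ muln_gt0 => /andP[].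
have nQ : n %/ (Q %/ p) = p ^ a.+1 by rewrite -{1}eQ mulKn.
split.
- have rpr : r %/ p %| r by rewrite -{2}rp dvdn_mulr.
  split=> //; first exact: dvdn_trans rpr rn.
  by move=> d d1 hd'; apply: small => //; apply: dvdn_trans hd' rpr.
- by exists w, a.+1.
- have hrp : 2 * (r %/ p) <= r by rewrite -{2}rp mulnC leq_mul2l p2 orbT.
  rewrite size_rcons expnS; split; first last.
  - by move: (r %/ p) hrp rp0 => r'; lia.
  - by rewrite addSn ht addnS.
  by apply: leq_trans h2; rewrite mulnAC [leqRHS]mulnC leq_mul2r hrp orbT.
split=> [i|h quiet hn hq].
  rewrite size_rcons ltnS nth_rcons => hi; case: ltnP => [/hk//|hi'].
  have -> : i = size T by lia.
  rewrite eqxx /=; split=> //; first by rewrite -eQ dvdn_mulr.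
  rewrite -eQ -{1}[Q %/ p]muln1 ltn_pmul2l //.
  by rewrite -{1}(expn0 p) ltn_exp2l.
have {}hd := hd h quiet hn.
have e : decode n quiet T * gcdn h (n %/ r) = n.
  apply: hd => i hi; rewrite hq ?size_rcons ?ltnS 1?ltnW //.
  by rewrite nth_rcons hi.
have := hq (size T); rewrite size_rcons ltnSn nth_rcons ltnn eqxx /= => /(_ isT) hqT.
rewrite decode_rcons /= hqT nQ er gcdnM_coprime // gcdn_pfactorS //.
rewrite ew gcdnM_coprime // in e.
case: ifP => dv //=.
(* The division by p in [decode] must be exact: p^(a+1) divides n, which is the current guess times
   p^a times a number coprime to p. *)
have pg : p %| decode n quiet T.
  have ga : gcdn h (p ^ a) = p ^ a.
    by apply/gcdn_idPr; apply: dvdn_trans dv; rewrite dvdn_exp2l.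
  have : p ^ a.+1 %| decode n quiet T * (gcdn h (p ^ a) * gcdn h w).
    by rewrite e -eQ dvdn_mull.
  rewrite ga mulnCA expnSr dvdn_pmul2l ?expn_gt0 ?p0 // Gauss_dvdl //.
  by apply: coprime_dvdr (dvdn_gcdr _ _) _; rewrite -(expn1 p).
by rewrite -!mulnA mulnA divnK.
Qed.

Lemma trial_inv0 : trial_inv 0 ([::], (n, 2, n)).
Proof.
split=> //.
- exists 1, 0; rewrite divnn n0 expn0 !muln1; split=> // q.
  by move=> /prime_gt1 q1 /dvdn_leq; lia.
- by rewrite mul1n.
by split=> // h q hn _; rewrite divnn n0 gcdn1 muln1.
Qed.

Lemma tests_spec : let T := tests n in
  [/\ 2 ^ size T <= n,
      forall i, i < size T ->
        let k := (nth (0, 0) T i).2 in [/\ 0 < k, k %| n & k < n] &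
      forall h quiet, h %| n ->
        (forall i, i < size T ->
           quiet i = (n %/ (nth (0, 0) T i).2 %| h)) ->
        decode n quiet T * h = n].
Proof.
have : trial_inv n.*2 (fstate n n.*2).
  rewrite /fstate; elim: n.*2 => [|t IH]; first exact: trial_inv0.
  exact: trial_inv_step.
rewrite /tests; case: (fstate _ _) => T [[r p] Q] /=.
case=> [[p2 r0 rn small] _ [h2 ht hT] [hk hd]].
(* Otherwise r, as a divisor of itself, would be at least p = 2n + 2 - size T, which exceeds n. *)
have r1 : r = 1.
  by apply/eqP; rewrite eqn_leq r0 andbT leqNgt; apply/negP => /small/(_ (dvdnn r));
     lia.
subst r; split=> // [|h q hn hq]; first by rewrite muln1 in h2.
by have := hd h q hn hq; rewrite divn1 (gcdn_idPl hn).
Qed.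

End TrialDivision.

(** * Subgroups of Z_n and their orders *)

Section CyclicGroup.
Variable n : nat.
Hypothesis n0 : 0 < n.
Implicit Type H : {group Zn n}.

Lemma order_inZp k : #[inZp k : Zn n]%g = n %/ gcdn n k.
Proof.
have e : n.-1.+1 = n by rewrite prednK.
have -> : inZp k = (inZp 1 ^+ k)%g :> Zn n.
  by apply/val_inj; rewrite Zp_expg /= modnMml mul1n.
have o1 : #[inZp 1 : Zn n]%g = n.
  by rewrite -[RHS]e -[in RHS](card_ord n.-1.+1) -cardsT orderE -Zp_cycle.
by rewrite orderXgcd o1.
Qed.

Lemma cyclic_Zn (G : {set Zn n}) : G = [set: Zn n] -> cyclic G.
Proof. by move=> ->; rewrite Zp_cycle cycle_cyclic. Qed.

Lemma card_Zn_dvd H : #|H| %| n.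
Proof.
by rewrite -[X in _ %| X]prednK // -[X in _ %| X]card_ord -cardsT cardSg ?subsetT.
Qed.

(** In a cyclic group inclusion of subgroups is divisibility of orders, and the subgroup generated
    by k has order n / k. For k = n / p^b the condition reads p^b | |H|. *)
Lemma mem_inZp H k : 0 < k -> k %| n -> (inZp k \in H) = (n %/ k %| #|H|).
Proof.
move=> k0 kn; rewrite -cycle_subG -(cardSg_cyclic (cyclic_Zn erefl)) ?subsetT //.
by rewrite -orderE order_inZp (gcdn_idPr kn).
Qed.

(** The decoded number is n / |H|, and a cyclic group has only one subgroup of each order. For
    trivial H the number is n itself, which [inZp] sends to 0. *)
Lemma decode_generates H quiet :
  (forall i, i < size (tests n) ->
     quiet i = (inZp (nth (0, 0) (tests n) i).2 \in H)) ->
  <[inZp (decode n quiet (tests n)) : Zn n]>%g = H.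
Proof.
move=> hq; have [_ hk hd] := tests_spec n0.
have e : decode n quiet (tests n) * #|H| = n.
  apply: hd; first exact: card_Zn_dvd.
  by move=> i hi; have [k0 kn _] := hk i hi; rewrite hq // mem_inZp.
have g0 : 0 < decode n quiet (tests n).
  by move: n0; rewrite -{1}e muln_gt0 => /andP[].
apply/eqP; rewrite (eq_subG_cyclic (cyclic_Zn erefl)) ?subsetT //.
have gn : decode n quiet (tests n) %| n by rewrite -[X in _ %| X]e dvdn_mulr.
by rewrite -orderE order_inZp (gcdn_idPr gn) -[X in X %/ _]e mulKn.
Qed.

End CyclicGroup.

Local Open Scope ring_scope.

(** * Gates *)

Section Gates.
Variable R : realType.
Notation C := R[i].

(** Gates are given by kernels on bit strings, so that the numbering by [enum_rank] is handled
    once. *)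
Definition kernel_gate a (f : bits a -> bits a -> C) : gate R :=
  @Gate R a (\matrix_(i, j) f (enum_val i) (enum_val j)).

Lemma valid_kernel_gate a (f : bits a -> bits a -> C) :
  (forall x y, \sum_z f x z * (f y z)^* = (x == y)%:R) ->
  (forall x y, algebraicOver (ratr : rat -> C) (f x y)) ->
  valid_gate (kernel_gate f).
Proof.
move=> uf af; split=> [|i j]; last by rewrite mxE.
apply/unitarymxP/matrixP => i j; rewrite !mxE -(inj_eq enum_val_inj) -uf.
rewrite (reindex_onto (@enum_rank _) (@enum_val _ _)); last first.
  by move=> k _; rewrite enum_valK.
apply: eq_big => [z|z _]; first by rewrite enum_rankK eqxx.
by rewrite !mxE enum_rankK.
Qed.

Definition rsqrt2 : R := Num.sqrt 2^-1.

Lemma rsqrt2_sqr : rsqrt2 * rsqrt2 = 2^-1.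
Proof. by rewrite -expr2 sqr_sqrtr // invr_ge0 ler0n. Qed.

Definition hadamard_kernel (x y : bits 1) : C :=
  (-1) ^+ (x ord0 && y ord0) * rsqrt2%:C%C.

Lemma sum_bits1 (V : nmodType) (F : bits 1 -> V) :
  \sum_y F y = F [ffun=> false] + F [ffun=> true].
Proof.
rewrite (reindex_onto (fun b : bool => [ffun=> b] : bits 1) (fun y => y ord0));
  last by move=> y _; apply/ffunP => i; rewrite ffunE (ord1 i).
rewrite (eq_bigl xpredT) => [|b]; last by rewrite ffunE eqxx.
by rewrite big_bool addrC.
Qed.

Lemma algebraic_sqrt2 : algebraicOver (ratr : rat -> C) rsqrt2%:C%C.
Proof.
exists ('X^2 - (2^-1)%:P); first by rewrite -size_poly_eq0 size_XnsubC.
rewrite /root rmorphB /= map_polyXn map_polyC /= !hornerE.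
by rewrite expr2 -rmorphM /= rsqrt2_sqr !fmorphV /= !rmorph_nat subrr.
Qed.

Lemma valid_hadamard : valid_gate (kernel_gate hadamard_kernel).
Proof.
apply: valid_kernel_gate => x y; last first.
  apply: algebraic_mul; last exact: algebraic_sqrt2.
  by case: (_ && _); rewrite ?expr1 ?expr0; [apply: algebraic_opp|];
    apply: algebraic1.
have bitsE (z : bits 1) : z = [ffun=> z ord0].
  by apply/ffunP => i; rewrite ffunE (ord1 i).
rewrite sum_bits1 (bitsE x) (bitsE y) /hadamard_kernel !ffunE.
have -> : ([ffun=> x ord0] == [ffun=> y ord0] :> bits 1) = (x ord0 == y ord0).
  by apply/eqP/eqP => [/ffunP/(_ ord0)|->]; rewrite ?ffunE.
have cJ : (rsqrt2%:C%C)^* = rsqrt2%:C%C :> C by apply: conjc_real.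
have c2 : rsqrt2%:C%C * rsqrt2%:C%C = 2^-1 :> C.
  by rewrite -rmorphM /= rsqrt2_sqr fmorphV rmorph_nat.
have sJ (b : bool) : ((-1) ^+ b)^* = (-1) ^+ b :> C by rewrite rmorphXn rmorphN1.
have E (a b : bool) : (-1) ^+ a * rsqrt2%:C%C * ((-1) ^+ b * rsqrt2%:C%C)^* =
    (-1) ^+ a * (-1) ^+ b * 2^-1 :> C.
  by rewrite rmorphM /= cJ sJ mulrACA c2.
by rewrite !E; case: (x ord0) (y ord0) => [] [] /=; rewrite ?(expr0, expr1); field.
Qed.

Definition controlled_swap (x : bits 3) : bits 3 :=
  if x ord0 then [ffun i => x (tperm (inord 1) (inord 2) i)] else x.

Lemma controlled_swapK : involutive controlled_swap.
Proof.
move=> x; rewrite /controlled_swap; case x0 : (x ord0); last by rewrite x0.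
have e : tperm (inord 1) (inord 2) ord0 = ord0 :> 'I_3.
  by rewrite tpermD // -val_eqE /= inordK.
by rewrite ffunE e x0; apply/ffunP => i; rewrite !ffunE tpermK.
Qed.

Lemma valid_controlled_swap :
  valid_gate (kernel_gate (fun x y => (y == controlled_swap x)%:R)).
Proof.
apply: valid_kernel_gate => x y; last first.
  by case: eqP => _; [apply: algebraic1 | apply: algebraic0].
rewrite (bigD1 (controlled_swap x)) //= eqxx mul1r big1 ?addr0 => [|z /negbTE->].
  by rewrite (can_eq controlled_swapK) rmorph_nat.
by rewrite mul0r.
Qed.

Definition gates (i : 'I_2) : gate R :=
  match val i with
  | 0 => kernel_gate hadamard_kernel
  | _ => kernel_gate (fun x y => (y == controlled_swap x)%:R)
  end.

Lemma valid_gates i : valid_gate (gates i).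
Proof.
case: i => [[|[|//]] hi]; [exact: valid_hadamard | exact: valid_controlled_swap].
Qed.

Variable N : nat.
Implicit Types (x : bits N) (psi : state R N).

Definition set_bit (w : 'I_N) b x : bits N := [ffun i => if i == w then b else x i].

Definition swap_bits (p q : 'I_N) x : bits N := [ffun i => x (tperm p q i)].

Definition H_app (w : 'I_N) : gapp gates N := @GApp R 2 gates N ord0 [tuple w].

Definition CSWAP_app (z p q : 'I_N) : gapp gates N :=
  @GApp R 2 gates N ord_max [tuple z; p; q].

Lemma apply_H psi w x : apply_gate psi (H_app w) x =
  rsqrt2%:C%C * (psi (set_bit w false x) + (-1) ^+ x w * psi (set_bit w true x)).
Proof.
rewrite ffunE /= sum_bits1 !mxE !enum_rankK /hadamard_kernel !ffunE (tnth_nth w) /=.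
have ow b : overwrite [tuple w] [ffun=> b] x = set_bit w b x.
  apply/ffunP => i; rewrite !ffunE; case: pickP => [j|h].
    by rewrite (tnth_nth w) (ord1 j) /= ffunE eq_sym => ->.
  by have := h ord0; rewrite (tnth_nth w) /= eq_sym => ->.
by rewrite !ow andbF andbT expr0; ring.
Qed.

Lemma apply_CSWAP psi z p q x : uniq [:: z; p; q] ->
  apply_gate psi (CSWAP_app z p q) x =
    psi (if x z then swap_bits p q x else x).
Proof.
rewrite /= !inE negb_or -!andbA => /and4P[zp zq pq _].
rewrite ffunE /=; set v := controlled_swap (bits_at [tuple z; p; q] x).
rewrite (bigD1 v) //= mxE !enum_rankK (eqxx v) mul1r big1 ?addr0; last first.
  by move=> y /negbTE yv; rewrite mxE !enum_rankK yv mul0r.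
congr (psi _); apply/ffunP => i; rewrite ffunE.
have t0 : tnth [tuple z; p; q] ord0 = z by [].
have t1 : tnth [tuple z; p; q] (inord 1) = p by rewrite (tnth_nth z) inordK.
have t2 : tnth [tuple z; p; q] (inord 2) = q by rewrite (tnth_nth z) inordK.
have ord3 (j : 'I_3) : [\/ j = ord0, j = inord 1 | j = inord 2].
  case: j => [[|[|[|//]]] hj]; [constructor 1|constructor 2|constructor 3];
  by apply/val_inj; rewrite /= ?inordK.
have e0 : tperm (inord 1) (inord 2) ord0 = ord0 :> 'I_3.
  by rewrite tpermD // -val_eqE /= inordK.
case: pickP => [j /eqP <-|h].
  rewrite /v /controlled_swap ffunE t0; case xz : (x z); last by rewrite !ffunE.
  rewrite !ffunE; congr (x _); case: (ord3 j) => ->.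
  - by rewrite e0 t0 tpermD // eq_sym.
  - by rewrite tpermL t1 t2 tpermL.
  - by rewrite tpermR t1 t2 tpermR.
case: ifP => // _; rewrite ffunE tpermD //.
  by have := h (inord 1); rewrite t1 => ->.
by have := h (inord 2); rewrite t2 => ->.
Qed.

End Gates.

(** * Rotations as sequences of swaps *)

Section Rotation.
Variables n a : nat.
Hypothesis n0 : (0 < n)%N.
Local Notation N := (n + a)%N.
Implicit Type y : bits N.

Lemma dim_gt0 : (0 < n + a)%N. Proof. by rewrite addn_gt0 n0. Qed.

(** Total in [j], so that gate lists are maps over [iota]; the default wire 0 is never reached for j
    < n + a. *)
Definition wire (j : nat) : 'I_N := insubd (Ordinal dim_gt0) j.

Lemma val_wire j : (j < N)%N -> wire j = j :> nat.
Proof. by move=> hj; rewrite val_insubd hj. Qed.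

Definition data_pred (i : 'I_N) : 'I_N :=
  match split i with
  | inl j => lshift a (ord_pred j)
  | inr j => rshift n j
  end.

Definition data_shift y : bits N := [ffun i => y (data_pred i)].

Definition data_bits y : bits n := [ffun i => y (lshift a i)].

Lemma data_bits_shift k y :
  data_bits (iter k data_shift y) = iter k (@shift n) (data_bits y).
Proof.
elim: k => //= k <-; apply/ffunP => i; rewrite !ffunE /data_pred.
by rewrite (unsplitK (inl _ i)).
Qed.

Lemma data_pred_anc (j : 'I_a) : data_pred (rshift n j) = rshift n j.
Proof. by rewrite /data_pred (unsplitK (inr _ j)). Qed.

Lemma data_shift_anc k y (j : 'I_a) :
  iter k data_shift y (rshift n j) = y (rshift n j).
Proof. by elim: k => //= k; rewrite ffunE data_pred_anc. Qed.

Lemma data_pred_eq_anc i (j : 'I_a) :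
  (data_pred i == rshift n j) = (i == rshift n j).
Proof.
rewrite /data_pred -{2}(splitK i); case: (split i) => i' //=.
by rewrite !eq_lrshift.
Qed.

Lemma data_shift_set_bit k y (j : 'I_a) b :
  iter k data_shift (set_bit (rshift n j) b y) =
  set_bit (rshift n j) b (iter k data_shift y).
Proof.
elim: k => //= k ->; apply/ffunP => i; rewrite !ffunE data_pred_eq_anc.
by case: eqP.
Qed.

Lemma data_pred_inj : injective data_pred.
Proof.
have inj_ord_pred : injective (@ord_pred n).
  by apply: can_inj (@ordS n) _ => i; rewrite ord_predK.
move=> i j; rewrite /data_pred -{2}(splitK i) -{2}(splitK j).
case: (split i) (split j) => i' [] j' /= /eqP.
- by rewrite eq_lshift => /eqP/inj_ord_pred ->.
- by rewrite eq_lrshift.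
- by rewrite eq_rlshift.
- by rewrite eq_rshift => /eqP ->.
Qed.

Lemma data_shift_bij k : bijective (iter k data_shift).
Proof.
have inj : injective data_shift.
  move=> y y' /ffunP e; apply/ffunP => i.
  have [g _ gK] := injF_bij data_pred_inj.
  by have := e (g i); rewrite !ffunE gK.
elim: k => [|k IH]; first by exists id.
by apply: bij_comp IH; apply: injF_bij.
Qed.

Lemma data_shift_comm k l y :
  iter k data_shift (iter l data_shift y) = iter l data_shift (iter k data_shift y).
Proof. by rewrite -!iterD (addnC k). Qed.

Lemma val_iter_data_pred k (i : 'I_N) : (k <= n)%N ->
  iter k data_pred i = (if i < n then (i + (n - k)) %% n else i)%N :> nat.
Proof.
elim: k => [|k IH] hk.
  by rewrite subn0 /= modnDr; case: ifP => // hi; rewrite modn_small.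
rewrite iterS; have {IH} := IH (ltnW hk); set j := iter k data_pred i.
case: ltnP => hi e.
  have jn : (j < n)%N by rewrite e ltn_pmod.
  have -> : j = lshift a (Ordinal jn) by apply/val_inj.
  rewrite /data_pred (unsplitK (inl _ _)) /= e.
  have -> : (((i + (n - k)) %% n + n).-1 = (i + (n - k)) %% n + n.-1)%N by lia.
  rewrite modnDml; have -> : (i + (n - k) + n.-1 = i + (n - k.+1) + n)%N by lia.
  by rewrite modnDr.
have hj : (j - n < a)%N by rewrite e; have := ltn_ord i; lia.
have -> : j = rshift n (Ordinal hj) by apply/val_inj => /=; rewrite subnKC // e.
by rewrite data_pred_anc /= subnKC e.
Qed.

Lemma iter_data_shiftE k y i : iter k data_shift y i = y (iter k data_pred i).
Proof. by elim: k i => //= k IH i; rewrite ffunE IH -iterSr. Qed.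

(** A state is a function of [y], so gates act on its argument in reverse order: the last swap of
    the circuit is the first applied to [y]. *)
Fixpoint swap_chain k m y : bits N :=
  if m is m'.+1 then
    swap_chain k m' (swap_bits (wire m') (wire (m' + k)) y) else y.

Fixpoint chain_pos k m (i : 'I_N) : 'I_N :=
  if m is m'.+1 then tperm (wire m') (wire (m' + k)) (chain_pos k m' i) else i.

Lemma swap_chainE k m y i : swap_chain k m y i = y (chain_pos k m i).
Proof. by elim: m y => //= m IH y; rewrite IH ffunE. Qed.

(* After m swaps, the bits of the first k positions occupy the positions m, ...,
   m + k - 1 with the same residues modulo k. *)
Lemma chain_posP k m (i : 'I_N) : (m + k <= n)%N -> (0 < k)%N ->
  let p := chain_pos k m i : nat in
  if (i < k)%N then is_true ((m <= p < m + k)%N && (p == i %[mod k])%N)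
  else p = (if (i < n) && (i < m + k) then i - k else i)%N.
Proof.
move=> + k0; elim: m => [|m IH] hm /=.
  by case: ltnP => hi; [rewrite eqxx andbT; lia | case: ifP; lia].
have {IH} := IH (ltnW hm); set q := chain_pos k m i => hq.
have v1 : wire m = m :> nat by rewrite val_wire //; lia.
have v2 : wire (m + k) = (m + k)%N :> nat by rewrite val_wire //; lia.
case: tpermP => [e|e|/eqP e1 /eqP e2].
- move: hq; rewrite e v1 v2; case: (ltnP i k) => hi.
    by case/andP=> _ /eqP h; rewrite modnDr h eqxx andbT; lia.
  by case: ifP => hc; case: ifP => hc'; lia.
- move: hq; rewrite e v1 v2; case: (ltnP i k) => hi; first by lia.
  by case: ifP => hc; case: ifP => hc'; lia.
rewrite -val_eqE /= v1 in e1; rewrite -val_eqE /= v2 in e2.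
move: hq e1 e2 => /=; move: (nat_of_ord q) => {}q.
case: (ltnP i k) => hi.
  by case/andP=> h ->; rewrite andbT; lia.
by case: ifP => hc; case: ifP => hc'; lia.
Qed.

(** The first k positions end up in the last block, from n - k on, with their residues modulo k. As
    k divides n - k, these residues say that the block arrives in its original order, so the chain
    is a rotation. *)
Lemma swap_chain_shift k y : (0 < k)%N -> (k %| n)%N ->
  swap_chain k (n - k) y = iter k data_shift y.
Proof.
move=> k0 kn; have le_kn := dvdn_leq n0 kn.
apply/ffunP => i; rewrite swap_chainE iter_data_shiftE; congr (y _).
apply/val_inj => /=; rewrite val_iter_data_pred //.
have := @chain_posP k (n - k) i; rewrite subnK // => /(_ (leqnn n) k0) /=.
move: (nat_of_ord (chain_pos _ _ _)) => p; case: (ltnP i k) => hi.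
  case/andP=> hp /eqP hm; have [hp1 hp2] := andP hp.
  have /dvdnP[c ec] : (k %| n - k)%N by rewrite dvdn_subr.
  move: hm; rewrite -(subnK hp1) {2}ec addnC modnMDl [in RHS]modn_small //.
  rewrite modn_small; last by lia.
  by move=> ->; rewrite (leq_trans hi le_kn) modn_small addnC //; lia.
move=> ->; case: (ltnP i n) => //= hi'.
have -> : (i + (n - k) = i - k + n)%N by lia.
by rewrite modnDr modn_small //; lia.
Qed.

End Rotation.

(** * Hadamard tests *)

Lemma set_set_bit N (w : 'I_N) b c (y : bits N) :
  set_bit w b (set_bit w c y) = set_bit w b y.
Proof. by apply/ffunP => i; rewrite !ffunE; case: eqP. Qed.

Lemma set_bit_id N (w : 'I_N) b (y : bits N) : y w = b -> set_bit w b y = y.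
Proof. by move=> <-; apply/ffunP => i; rewrite !ffunE; case: eqP => [->|]. Qed.

Section HadamardTest.
Variable R : realType.
Notation C := R[i].

Definition nsq (z : C) : R := complex.Re z ^+ 2 + complex.Im z ^+ 2.

Lemma nsq_ge0 z : 0 <= nsq z.
Proof. by rewrite addr_ge0 ?sqr_ge0. Qed.

Lemma nsq_parallelogram (u v : C) :
  nsq (2^-1 * (u + v)) + nsq (2^-1 * (u - v)) = 2^-1 * (nsq u + nsq v).
Proof.
have -> : 2^-1 = (2^-1 : R)%:C%C :> C by rewrite fmorphV rmorph_nat.
by case: u v => [a b] [c d]; rewrite /nsq /=; field.
Qed.

Lemma nsq_sub_add (u v : C) : 2^-1 * (nsq (u + v) + nsq (u - v)) = nsq u + nsq v.
Proof. by case: u v => [a b] [c d]; rewrite /nsq /=; field. Qed.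

Variables n a : nat.
Hypothesis n0 : (0 < n)%N.
Local Notation N := (n + a)%N.
Local Notation rot k := (iter k (@data_shift n a)).
Local Notation anc := (@rshift n a).
Implicit Types (y : bits N) (phi : state R N) (psi : state R n).

(** Hadamard, controlled rotation, Hadamard in closed form, for any state of the ancilla and not
    only |0>. Applying [rot k] to the argument of a state is T^(-k) on the data. *)
Definition test_op (j : 'I_a) k phi : state R N := [ffun y =>
  2^-1 * (phi (set_bit (anc j) false y) + phi (set_bit (anc j) true y) +
    (-1) ^+ y (anc j) * (phi (rot k (set_bit (anc j) false y)) -
                         phi (rot k (set_bit (anc j) true y))))].

Definition test_gates (z : 'I_N) k : seq (gapp (@gates R) N) :=
  H_app R z ::
    [seq CSWAP_app R z (wire a n0 j) (wire a n0 (j + k)) | j <- iota 0 (n - k)]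
    ++ [:: H_app R z].

Lemma uniq_test_wires (j : 'I_a) k m : (0 < k)%N -> (m + k < n)%N ->
  uniq [:: anc j; wire a n0 m; wire a n0 (m + k)].
Proof.
move=> k0 hm; rewrite /= !inE negb_or andbT -!val_eqE /= !val_wire; lia.
Qed.

(** The control is not among the swapped wires, so its value decides once for the whole chain. *)
Lemma foldl_CSWAP (j : 'I_a) k m phi y : (0 < k)%N -> (m + k <= n)%N ->
  foldl (@apply_gate R 2 (@gates R) N) phi
    [seq CSWAP_app R (anc j) (wire a n0 i) (wire a n0 (i + k)) | i <- iota 0 m] y =
  phi (if y (anc j) then swap_chain n0 k m y else y).
Proof.
move=> k0; elim: m y => [|m IH] y hm; first by rewrite if_same.
have -> : iota 0 m.+1 = iota 0 m ++ [:: m] by rewrite -[m.+1]addn1 iotaD.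
rewrite map_cat foldl_cat /= apply_CSWAP; last exact: uniq_test_wires.
rewrite IH; last exact: ltnW.
case yj : (y (anc j)); last by rewrite yj.
rewrite ffunE tpermD ?yj //; have := @uniq_test_wires j k m k0 hm;
  by rewrite /= !inE negb_or eq_sym [_ == wire _ _ (_ + _)]eq_sym => /andP[/andP[]].
Qed.

Lemma run_test_gates (j : 'I_a) k phi : (0 < k)%N -> (k %| n)%N ->
  foldl (@apply_gate R 2 (@gates R) N) phi (test_gates (anc j) k) =
  test_op j k phi.
Proof.
move=> k0 kn; apply/ffunP => y.
rewrite /test_gates /= foldl_cat /= apply_H.
have hk : (n - k + k <= n)%N by rewrite subnK // dvdn_leq.
rewrite !foldl_CSWAP // [set_bit _ false y _]ffunE [set_bit _ true y _]ffunE eqxx.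
rewrite swap_chain_shift // !apply_H !data_shift_anc !ffunE eqxx.
rewrite -!data_shift_set_bit !set_set_bit expr0 expr1 mul1r mulN1r.
set s := (-1) ^+ _; set A := phi _ + _; set B := _ - _.
have c2 : (rsqrt2 R)%:C%C * (rsqrt2 R)%:C%C = 2^-1 :> C.
  by rewrite -rmorphM /= rsqrt2_sqr fmorphV rmorph_nat.
by rewrite -c2; ring.
Qed.


Lemma sum_pair (j : 'I_a) (P : pred (bits N)) (F : bits N -> R) :
  (forall y b, P (set_bit (anc j) b y) = P y) ->
  \sum_(y | P y) F y =
  \sum_(y | P y && ~~ y (anc j)) (F y + F (set_bit (anc j) true y)).
Proof.
move=> hP; rewrite (bigID (fun y => ~~ y (anc j))) /= big_split; congr (_ + _).
rewrite (reindex_onto (set_bit (anc j) true) (set_bit (anc j) false)); last first.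
  by move=> y /andP[_ /negPn yj]; rewrite set_set_bit set_bit_id.
apply: eq_bigl => y; rewrite hP set_set_bit ffunE eqxx /= andbT; congr (_ && _).
apply/eqP/idP => [<-|/negbTE yj]; first by rewrite ffunE eqxx.
by rewrite set_bit_id.
Qed.

Lemma sum_rot k (P : pred (bits N)) (F : bits N -> R) :
  (forall y, P (rot k y) = P y) -> \sum_(y | P y) F (rot k y) = \sum_(y | P y) F y.
Proof.
move=> hP; rewrite [RHS](reindex (rot k)).
  by apply: eq_bigl => y; rewrite hP.
exact/onW_bij/data_shift_bij.
Qed.

(* The test is an isometry that commutes with the measurement of the other
   qubits. *)
Lemma test_op_norm (j : 'I_a) k phi (P : pred (bits N)) :
  (forall y b, P (set_bit (anc j) b y) = P y) -> (forall y, P (rot k y) = P y) ->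
  \sum_(y | P y) nsq (test_op j k phi y) = \sum_(y | P y) nsq (phi y).
Proof.
move=> hP hr; rewrite !(sum_pair _ hP).
(* Up to a factor, [A] and [B] are the amplitudes of ancilla values 0 and 1 after the first
   Hadamard. The controlled rotation permutes those in [B] only, and each Hadamard preserves the sum
   of squares by the parallelogram law. *)
pose A y := phi y + phi (set_bit (anc j) true y).
pose B y := phi y - phi (set_bit (anc j) true y).
transitivity (\sum_(y | P y && ~~ y (anc j)) 2^-1 * (nsq (A y) + nsq (B (rot k y)))).
  apply: eq_bigr => y /andP[_ /negbTE yj].
  rewrite -nsq_parallelogram !ffunE eqxx yj !set_set_bit expr0 expr1 mul1r mulN1r.
  by rewrite (set_bit_id yj) data_shift_set_bit.
rewrite -mulr_sumr big_split /= (@sum_rot k (fun y => P y && ~~ y (anc j))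
  (fun y => nsq (B y))) => [|y]; last by rewrite hr data_shift_anc.
rewrite -big_split mulr_sumr; apply: eq_bigr => y _; exact: nsq_sub_add.
Qed.

(** The unnormalised data state left by a test with outcome b on a fresh ancilla, namely (1 + (-1)^b
    T^(-k)) / 2 applied to psi. *)
Definition sign_avg (b : bool) k psi : state R n :=
  [ffun x => 2^-1 * (psi x + (-1) ^+ b * psi (iter k (@shift n) x))].

Definition data_sign_avg (b : bool) k phi : state R N :=
  [ffun y => 2^-1 * (phi y + (-1) ^+ b * phi (rot k y))].

(** This is where commutation of the translations enters; it lets the effect of one test be moved in
    front of the earlier ones. *)
Lemma test_op_sign_avg (j : 'I_a) b k l phi :
  test_op j l (data_sign_avg b k phi) = data_sign_avg b k (test_op j l phi).
Proof.
apply/ffunP => y; rewrite !ffunE data_shift_anc -!data_shift_set_bit.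
by rewrite ![iter k _ (iter l _ _)]data_shift_comm; ring.
Qed.

Lemma with_ancillas_sign_avg b k psi :
  data_sign_avg b k (with_ancillas a psi) = with_ancillas a (sign_avg b k psi).
Proof.
apply/ffunP => y; rewrite !ffunE.
have -> : [forall i, ~~ rot k y (anc i)] = [forall i, ~~ y (anc i)].
  by apply: eq_forallb => i; rewrite data_shift_anc.
case: ifP => _; last by ring.
by rewrite -(data_bits_shift k y).
Qed.

Variable ks : nat -> nat.

(** [insub] makes the recursion total in [t]; its default branch is not taken while t <= a. *)
Fixpoint run_tests (t : nat) psi : state R N :=
  if t is t'.+1 then
    if insub t' is Some j then test_op j (ks t') (run_tests t' psi)
    else run_tests t' psi
  else with_ancillas a psi.

Lemma run_testsS t (ta : (t < a)%N) psi :
  run_tests t.+1 psi = test_op (Ordinal ta) (ks t) (run_tests t psi).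
Proof. by rewrite /= insubT. Qed.

Lemma run_tests_sign_avg b k t psi : (t <= a)%N ->
  data_sign_avg b k (run_tests t psi) = run_tests t (sign_avg b k psi).
Proof.
elim: t => [|t IH] ta; first exact: with_ancillas_sign_avg.
by rewrite !(run_testsS ta) -test_op_sign_avg IH // ltnW.
Qed.

(** Ancilla i is still 0 before its own test, since earlier tests touch only their own ancillas and
    the data. *)
Lemma run_tests_fresh t psi (i : 'I_a) y : (t <= i)%N -> y (anc i) ->
  run_tests t psi y = 0.
Proof.
elim: t y => [|t IH] y ti yi.
  by rewrite ffunE; case: forallP => // /(_ i); rewrite yi.
have ta := ltn_trans ti (ltn_ord i); rewrite (run_testsS ta) !ffunE.
have ne : (anc i == anc (Ordinal ta)) = false.
  by rewrite eq_rshift -val_eqE /= gtn_eqF.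
rewrite !IH ?(ltnW ti) ?data_shift_anc ?ffunE ?ne //; by ring.
Qed.

(** Events that depend neither on later ancillas nor on a rotation of the data keep their
    probability during the later tests. *)
Lemma run_tests_norm t (P : pred (bits N)) psi t' :
  (forall y b (j : 'I_a), (t' <= j)%N -> P (set_bit (anc j) b y) = P y) ->
  (forall k y, P (rot k y) = P y) -> (t' <= t <= a)%N ->
  \sum_(y | P y) nsq (run_tests t psi y) = \sum_(y | P y) nsq (run_tests t' psi y).
Proof.
move=> hP hr; elim: t => [|t IH] /andP[tt' ta].
  by move: tt'; rewrite leqn0 => /eqP->.
move: tt'; rewrite leq_eqVlt ltnS => /orP[/eqP-> //|tt'].
rewrite (run_testsS ta) test_op_norm => [|y b|y] //; last exact: hP.
by apply: IH; rewrite tt' ltnW.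
Qed.

Lemma with_ancillas_norm psi :
  \sum_y nsq (with_ancillas a psi y) = \sum_x nsq (psi x).
Proof.
pose up (x : bits n) : bits N :=
  [ffun i => if split i is inl i' then x i' else false].
rewrite (bigID (fun y : bits N => [forall i : 'I_a, ~~ y (anc i)])) /= addrC.
rewrite big1 => [|y]; last first.
  by rewrite ffunE => /negbTE->; rewrite /nsq /= expr0n addr0.
rewrite add0r (reindex_onto up (@data_bits n a)) => [|y /forallP hy].
  apply: eq_big => [x|x hx].
    have -> : [forall i, ~~ up x (anc i)].
      by apply/forallP => i; rewrite ffunE (unsplitK (inr _ i)).
    by apply/eqP/ffunP => i; rewrite !ffunE (unsplitK (inl _ i)).
  rewrite ffunE; have [/andP[-> _]] := conj hx I => _.
  by congr (nsq (psi _)); apply/ffunP => i; rewrite !ffunE (unsplitK (inl _ i)).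
apply/ffunP => i; rewrite ffunE -{2}(splitK i); case: (split i) => i' /=.
  by rewrite ffunE.
by apply/esym/negbTE/hy.
Qed.

Lemma run_tests_total psi : \sum_y nsq (run_tests a psi y) = \sum_x nsq (psi x).
Proof. by rewrite (@run_tests_norm a xpredT psi 0) //= with_ancillas_norm. Qed.

(** The tests after i do not affect the event. Test i with outcome b applies the sign average to the
    state left by the earlier tests; moved in front of them by commutation, it acts on psi itself,
    and the other tests preserve the norm. *)
Lemma run_tests_marginal psi (i : 'I_a) b :
  \sum_(y : bits N | y (anc i) == b) nsq (run_tests a psi y) =
  \sum_x nsq (sign_avg b (ks i) psi x).
Proof.
rewrite (@run_tests_norm a _ psi i.+1) ?ltn_ord ?leqnn //; first last.
- by move=> k y; rewrite data_shift_anc.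
- by move=> y c j ij; rewrite ffunE eq_rshift -val_eqE /= ltn_eqF.
rewrite (run_testsS (ltn_ord i)); have -> : Ordinal (ltn_ord i) = i by apply/val_inj.
set phi := run_tests i psi.
have fresh y : y (anc i) -> phi y = 0 by apply: run_tests_fresh.
(* The right-hand side is expressed through [phi] as well: let the averaged state pass through the
   first i tests, then take the average out. The two sums are then matched term by term, with
   ancilla i set to b on the left and 0 on the right. *)
rewrite -(run_tests_total (sign_avg b (ks i) psi)) (@run_tests_norm a xpredT _ i) //;
  last by rewrite (ltnW (ltn_ord i)) leqnn.
rewrite -run_tests_sign_avg ?(ltnW (ltn_ord i)) // -/phi.
rewrite [RHS](bigID (fun y : bits N => y (anc i) == false)) /=.
rewrite [X in _ + X]big1 ?addr0; last first.
  move=> y; rewrite eqbF_neg negbK => yi; rewrite ffunE !fresh ?data_shift_anc //.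
  by rewrite mulr0 addr0 mulr0 /nsq /= expr0n addr0.
rewrite (reindex_onto (set_bit (anc i) b) (set_bit (anc i) false)); last first.
  by move=> y /eqP yi; rewrite set_set_bit set_bit_id.
apply: eq_big => [y|y].
  rewrite ffunE eqxx eqxx set_set_bit /=; apply/eqP/eqP => [<-|yi].
    by rewrite ffunE eqxx.
  by rewrite set_bit_id.
rewrite ffunE eqxx eqxx set_set_bit /= => /eqP yi.
rewrite !ffunE eqxx !set_set_bit yi !(fresh (set_bit _ true _)) ?ffunE ?eqxx //.
rewrite !(fresh (rot _ (set_bit _ true _))) ?data_shift_anc ?ffunE ?eqxx //.
by rewrite addr0 subr0.
Qed.

End HadamardTest.

(** * The measurement *)

Section Translation.
Variables (R : realType) (n : nat).
Implicit Type psi : state R n.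

Lemma shift_bij k : bijective (iter k (@shift n)).
Proof.
elim: k => [|k IH]; first by exists id.
apply: bij_comp IH; exists (fun x : bits n => [ffun i => x (ordS i)]) => x;
  by apply/ffunP => i; rewrite !ffunE (ordSK, ord_predK).
Qed.

Lemma transl_shift k psi x : iter k (@transl R n) psi (iter k (@shift n) x) = psi x.
Proof.
elim: k => //= k IH; rewrite ffunE (big_pred1 (iter k (@shift n) x)) ?IH // => y.
by rewrite /= (inj_eq (bij_inj (shift_bij 1))).
Qed.

Lemma Re_sum (I : finType) (F : I -> R[i]) :
  complex.Re (\sum_i F i) = \sum_i complex.Re (F i).
Proof. by apply: (big_morph (@complex.Re R)) => // -[? ?] [? ?]. Qed.

(** Substituting the shifted string for x removes the preimages in [transl]. The circuit applies
    T^(-k) rather than T^k, but the real part of the inner product is the same. *)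
Lemma Re_inner_transl k psi : complex.Re (inner psi (iter k (@transl R n) psi)) =
  \sum_x (complex.Re (psi (iter k (@shift n) x)) * complex.Re (psi x) +
          complex.Im (psi (iter k (@shift n) x)) * complex.Im (psi x)).
Proof.
rewrite Re_sum (reindex (iter k (@shift n))); last exact/onW_bij/shift_bij.
apply: eq_bigr => x _; rewrite transl_shift.
by case: (psi _) (psi _) => [? ?] [? ?] /=; ring.
Qed.

Lemma sum_nsq psi : \sum_x nsq (psi x) = complex.Re (inner psi psi).
Proof. by rewrite (Re_inner_transl 0); apply: eq_bigr => x _; rewrite -!expr2. Qed.

Lemma sign_avg_norm b k psi : inner psi psi = 1 ->
  \sum_x nsq (sign_avg b k psi x) =
  2^-1 * (1 + (-1) ^+ b * complex.Re (inner psi (iter k (@transl R n) psi))).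
Proof.
move=> psi1; have tot : \sum_x nsq (psi x) = 1 by rewrite sum_nsq psi1.
have tot' : \sum_x nsq (psi (iter k (@shift n) x)) = 1.
  by rewrite -tot [RHS](reindex (iter k (@shift n))) //; exact/onW_bij/shift_bij.
rewrite Re_inner_transl; set S := (X in _ = _ * (_ + _ * X)).
have -> : 2^-1 * (1 + (-1) ^+ b * S) = 4^-1 * (\sum_x nsq (psi x) +
    \sum_x nsq (psi (iter k (@shift n) x))) + 2^-1 * (-1) ^+ b * S.
  by rewrite tot tot'; field.
rewrite -big_split !mulr_sumr -big_split; apply: eq_bigr => x _ /=.
rewrite ffunE.
have -> : 2^-1 = (2^-1 : R)%:C%C :> R[i] by rewrite fmorphV rmorph_nat.
case: (psi _) (psi _) => [u v] [p q]; rewrite /nsq.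
by case: b; rewrite ?expr0 ?expr1 /=; field.
Qed.

(** A norm is nonnegative, so one k outside H already forces eps < 1; this is what gives m > 0 when
    some test should fire. *)
Lemma hidden_translation_Re eps (H : {group Zn n}) psi (k : Zn n) :
  hidden_translation eps H psi ->
  if k \in H then complex.Re (inner psi (iter k (@transl R n) psi)) = 1
  else eps < 1 /\ complex.Re (inner psi (iter k (@transl R n) psi)) < 1 - eps.
Proof.
case=> psi1 hin hout; case: ifP => kH; first by rewrite hin // psi1.
have := hout k (negbT kH); rewrite normc_def ltcR => h.
split; first by rewrite -subr_gt0; apply: le_lt_trans h; apply: sqrtr_ge0.
apply: le_lt_trans h; set z := inner _ _.
apply: le_trans (ler_norm _) _; rewrite -sqrtr_sqr ler_wsqrtr //.
by rewrite lerDl sqr_ge0.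
Qed.

End Translation.

(** * The circuit of all tests and its encoding *)

Section Circuit.
Variables (R : realType) (n : nat) (T : seq (nat * nat)).
Hypothesis n0 : (0 < n)%N.
Hypothesis T_spec : forall i, (i < size T)%N ->
  let k := (nth (0, 0)%N T i).2 in [/\ (0 < k)%N, (k %| n)%N & (k < n)%N].

Let a := size T.
Let ks i := (nth (0, 0)%N T i).2.

Definition tests_gates : seq (gapp (@gates R) (n + a)) :=
  flatten [seq test_gates R n0 (wire a n0 (n + i)) (ks i) | i <- iota 0 a].

Definition tests_circuit : circuit (@gates R) (n + a) :=
  [seq [:: g] | g <- tests_gates].

Lemma wire_anc i (ia : (i < a)%N) : wire a n0 (n + i) = rshift n (Ordinal ia).
Proof. by apply/val_inj; rewrite /= val_wire // ltn_add2l. Qed.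

Lemma run_tests_circuit psi :
  run_circuit tests_circuit (with_ancillas a psi) = run_tests a ks a psi.
Proof.
have -> : run_circuit tests_circuit (with_ancillas a psi) =
    foldl (@apply_gate R 2 (@gates R) (n + a)) (with_ancillas a psi) tests_gates.
  rewrite /run_circuit /tests_circuit.
  by elim: tests_gates (with_ancillas _ _) => //= g l IH phi; rewrite IH.
rewrite /tests_gates; suff: forall t, (t <= a)%N ->
    foldl (@apply_gate R 2 (@gates R) (n + a)) (with_ancillas a psi)
      (flatten [seq test_gates R n0 (wire a n0 (n + i)) (ks i) | i <- iota 0 t]) =
    run_tests a ks t psi by apply.
elim=> [//|t IH] ta; have -> : iota 0 t.+1 = iota 0 t ++ [:: t].
  by rewrite -[t.+1]addn1 iotaD.
rewrite map_cat flatten_cat foldl_cat IH ?(ltnW ta) // (run_testsS _ ta).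
have [k0 kn _] := T_spec ta.
by rewrite -(run_test_gates n0) // -wire_anc /= cats0.
Qed.

Lemma encode_tests_circuit :
  encode_circuit tests_circuit = gates_count n T :: tests_code n T.
Proof.
rewrite /encode_circuit /tests_circuit size_map; congr (_ :: _).
  rewrite /tests_gates size_flatten /shape -map_comp /gates_count; congr sumn.
  apply: (@eq_from_nth _ 0%N) => [|i]; rewrite !size_map size_iota // => ia.
  rewrite (nth_map 0%N) ?size_iota // (nth_map (0, 0)%N) // nth_iota //=.
  by rewrite size_cat size_map size_iota /= addn1 addn2.
rewrite -map_comp /tests_gates /tests_code.
have : all (fun i => i < a)%N (iota 0 a) by apply/allP => i; rewrite mem_iota.
elim: (iota 0 a) => //= i l IH /andP[ia /IH {}IH].
rewrite !map_cat !flatten_cat -{}IH /= -!map_comp; have [k0 kn kltn] := T_spec ia.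
rewrite !val_wire ?ltn_add2l //; congr [:: _, _, _ & _ ++ _].
congr (flatten _ ++ _).
apply/eq_in_map => j; rewrite mem_iota add0n => /= hj.
have jn : (j + (nth (0, 0)%N T i).2 < n + a)%N.
  by move: hj; rewrite /ks; lia.
by rewrite /encode_layer /= !val_wire ?ltn_add2l //
  (leq_ltn_trans (leq_addr _ _) jn).
Qed.

Lemma wf_tests_circuit : wf_circuit tests_circuit.
Proof.
rewrite /wf_circuit /tests_circuit all_map /tests_gates.
have : all (fun i => i < a)%N (iota 0 a) by apply/allP => i; rewrite mem_iota.
elim: (iota 0 a) => //= i l IH /andP[ia /IH {}IH].
rewrite !all_cat IH /= all_map !andbT wire_anc.
apply/allP => j; rewrite mem_iota add0n => /= hj.
have [k0 kn kltn] := T_spec ia.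
by apply: (@uniq_test_wires n (size T) n0 (Ordinal ia)) => //; move: hj;
  rewrite /ks; lia.
Qed.

Lemma outcome_probE psi y :
  outcome_prob tests_circuit psi y = nsq (run_tests a ks a psi y).
Proof. by rewrite /outcome_prob run_tests_circuit. Qed.

End Circuit.

(** * Sampling *)

Section Sampling.
Variable R : realFieldType.

Lemma sum_tuple_prod (A : finType) (s : nat) (Q : pred A) (P : A -> R) :
  \sum_(Y : s.-tuple A | [forall j, Q (tnth Y j)]) \prod_(j < s) P (tnth Y j) =
  (\sum_(y | Q y) P y) ^+ s.
Proof.
rewrite -[X in _ ^+ X]card_ord -prodr_const bigA_distr_big.
rewrite (reindex (fun f : {ffun 'I_s -> A} => [tuple f i | i < s])).
  apply: eq_big => [f|f _]; last by apply: eq_bigr => i _; rewrite tnth_mktuple.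
  by apply/forallP/ffun_onP => h i; have := h i; rewrite tnth_mktuple.
exists (fun Y => [ffun i => tnth Y i]) => [f|Y] _.
  by apply/ffunP => i; rewrite ffunE tnth_mktuple.
by apply: eq_from_tnth => i; rewrite tnth_mktuple ffunE.
Qed.

(** An inverse Bernoulli inequality: the induction step is (1 + (s + 1) delta)(1 - delta) <= 1 + s
    delta. It takes the place of an exponential tail bound. *)
Lemma bernoulli_inv (q delta : R) s : 0 <= q -> 0 <= delta -> q <= 1 - delta ->
  (1 + s%:R * delta) * q ^+ s <= 1.
Proof.
move=> q0 d0 qd; elim: s => [|s IH]; first by rewrite expr0 mul0r addr0 mulr1.
apply: le_trans IH; rewrite exprS mulrA ler_wpM2r ?exprn_ge0 //.
have s0 : 0 <= s%:R :> R by rewrite ler0n.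
rewrite -natr1; move: (s%:R : R) s0 => t t0.
have dd : 0 <= (t + 1) * (delta * delta) by rewrite mulr_ge0 ?mulr_ge0 // addr_ge0.
have td : 0 <= t * delta by rewrite mulr_ge0.
have h : (1 + (t + 1) * delta) * q <= (1 + (t + 1) * delta) * (1 - delta).
  by rewrite ler_wpM2l //; lra.
by apply: le_trans h _; move: dd; lra.
Qed.

(** The error is one-sided: a test in H almost surely stays quiet, so the only failure is that a
    test outside H is quiet in all s samples. The budget 1/3 is shared equally; multiplying by a
    instead of dividing covers a = 0. *)
Lemma success_probability (A : finType) (P : A -> R) (a s : nat)
    (fires : 'I_a -> pred A) (inH : pred 'I_a) (good : pred (s.-tuple A)) :
  (forall y, 0 <= P y) -> \sum_y P y = 1 ->
  (forall i y, inH i -> fires i y -> P y = 0) ->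
  (forall i, ~~ inH i -> a%:R * (\sum_(y | ~~ fires i y) P y) ^+ s <= 3^-1) ->
  (forall Y : s.-tuple A,
     (forall i, [forall j, ~~ fires i (tnth Y j)] = inH i) -> good Y) ->
  2 / 3 <= \sum_(Y | good Y) \prod_(j < s) P (tnth Y j).
Proof.
move=> P0 P1 hin hout hgood.
pose pr (Y : s.-tuple A) := \prod_(j < s) P (tnth Y j).
have pr0 Y : 0 <= pr Y by apply: prodr_ge0.
pose bad i (Y : s.-tuple A) := [forall j, ~~ fires i (tnth Y j)] != inH i.
have tot : \sum_Y pr Y = 1.
  rewrite -[RHS](expr1n R s) -P1 -sum_tuple_prod; apply: eq_bigl => Y.
  by apply/esym/forallP.
have hbad i : a%:R * \sum_(Y | bad i Y) pr Y <= 3^-1.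
  case hi : (inH i).
    rewrite big1 ?mulr0 ?invr_ge0 ?ler0n // => Y.
    rewrite /bad hi eqb_id negb_forall => /existsP[j]; rewrite negbK => fj.
    by rewrite /pr (bigD1 j) //= (hin _ _ hi fj) mul0r.
  rewrite (eq_bigl (fun Y : s.-tuple A => [forall j, ~~ fires i (tnth Y j)])).
    by rewrite (@sum_tuple_prod A s (fun y => ~~ fires i y)) hout ?hi.
  by move=> Y; rewrite /bad hi eqbF_neg negbK.
have union : \sum_Y pr Y <= \sum_(Y | good Y) pr Y + \sum_i \sum_(Y | bad i Y) pr Y.
  rewrite (bigID good) /= lerD2l; under [leRHS]eq_bigr do rewrite big_mkcond.
  rewrite exchange_big /= big_mkcond; apply: ler_sum => Y _.
  case: ifPn => hY; last by apply: sumr_ge0 => i _; case: ifP.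
  have [i hi] : exists i, bad i Y.
    apply/existsP; apply: contraNT hY => /existsPn nbad; apply: hgood => i.
    by have := nbad i; rewrite /bad negbK => /eqP.
  rewrite (bigD1 i) //= hi lerDl; apply: sumr_ge0 => j _; by case: ifP.
have bads : \sum_i \sum_(Y | bad i Y) pr Y <= 3^-1.
  case: a fires inH hin hout hgood bad hbad union
    => [|a'] fires' inH' _ _ _ bad' hbad _.
    by rewrite big_ord0 invr_ge0 ler0n.
  have h i : \sum_(Y | bad' i Y) pr Y <= a'.+1%:R^-1 * 3^-1.
    by rewrite ler_pdivlMl ?ltr0Sn.
  apply: le_trans (ler_sum _ (fun i _ => h i)) _.
  by rewrite sumr_const card_ord -[leLHS]mulr_natl mulVKf ?pnatr_eq0 ?lexx.
rewrite tot in union; move: union bads; rewrite /pr; set x := \sum_(Y | good Y) _.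
by move=> h1 h2; lra.
Qed.

End Sampling.

Lemma nth_flatten_const (N : nat) (ss : seq (seq nat)) j r :
  all (fun l => size l == N) ss -> (j < size ss)%N -> (r < N)%N ->
  nth 0%N (flatten ss) (j * N + r) = nth 0%N (nth [::] ss j) r.
Proof.
elim: ss j => //= l ss IH [|j] /andP[/eqP hl hss] hj hr; rewrite nth_cat hl.
  by rewrite mul0n add0n hr.
by rewrite mulSn -addnA ltnNge leq_addr addKn IH.
Qed.

Lemma silentE n m s a (Y : s.-tuple (bits (n + a))) (i : 'I_a) :
  silent ([:: n; m; s; a] ++ flatten [seq encode_bits y | y <- Y]) n (n + a) s i =
  [forall j, ~~ tnth Y j (rshift n i)].
Proof.
rewrite /silent sum_nat_eq0; apply: eq_forallb => j /=.
rewrite add0n [(n + i + _)%N]addnC nth_flatten_const ?ltn_add2l //; last first.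
- by rewrite size_map size_tuple.
- by rewrite all_map; apply/allP => y _; rewrite /= size_map -cardE card_ord.
have y0 := tnth Y j.
rewrite (nth_map y0) ?size_tuple // -tnth_nth /encode_bits.
rewrite (nth_map (rshift n i)) -?cardE ?card_ord ?ltn_add2l //.
have -> : nth (rshift n i) (enum 'I_(n + a)) (n + i) = rshift n i.
  by apply/val_inj; rewrite /= nth_enum_ord // ltn_add2l.
by rewrite eqb0.
Qed.

(** * Estimates for the resource bounds *)

Section RealBounds.
Variable R : realType.

(** For m >= 1 one has 1 / eps < m + 1 <= 2 m. The factor 2 lost by rounding is the reason for 12
    instead of 6 in s. *)
Lemma truncn_inv_bound (eps : R) : 0 < eps ->
  (Num.truncn eps^-1)%:R <= eps^-1 /\
  ((0 < Num.truncn eps^-1)%N -> 2^-1 <= (Num.truncn eps^-1)%:R * eps) /\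
  (Num.truncn eps^-1 = 0%N -> 1 < eps).
Proof.
move=> e0; have ei0 : 0 <= eps^-1 by rewrite invr_ge0 ltW.
have /andP[h1 h2] := truncn_itv ei0; split=> //; split=> [m0|m0].
  have h3 : eps^-1 <= (Num.truncn eps^-1)%:R * 2.
    apply: le_trans (ltW h2) _; rewrite -natrM ler_nat; lia.
  have : eps^-1 * eps <= (Num.truncn eps^-1)%:R * 2 * eps by rewrite ler_pM2r.
  by rewrite mulVf ?gt_eqF //; lra.
by move: h2; rewrite m0 invf_lt1.
Qed.

(** The constant exceeds 1 / ln 2. No additive constant is needed even at n = 1, where ln n = 0,
    because 2^a <= 1 forces a = 0. *)
Lemma exp2_ln : exists c0 : nat, forall a n : nat, (0 < n)%N -> (2 ^ a <= n)%N ->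
  a%:R <= c0%:R * ln (n%:R : R).
Proof.
have l2 : 0 < ln (2 : R) by rewrite ln_gt0 // ltr1n.
exists (Num.truncn (ln (2 : R))^-1).+1 => a n n0 h.
have h1 : a%:R * ln 2 <= ln (n%:R : R).
  have -> : a%:R * ln (2 : R) = ln (2 ^+ a) by rewrite lnXn // mulr_natl.
  by rewrite ler_ln ?posrE ?exprn_gt0 ?ltr0n // -natrX ler_nat.
have /andP[_ h2] := truncn_itv (ltW (etrans (invr_gt0 _) l2)).
apply: le_trans (ler_wpM2l (ler0n _ _) h1); rewrite mulrCA.
rewrite ler_peMr ?ler0n //.
have : (ln (2 : R))^-1 * ln 2 <= (Num.truncn (ln (2 : R))^-1).+1%:R * ln 2.
  by rewrite ler_pM2r // ltW.
by rewrite mulVf ?gt_eqF.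
Qed.

End RealBounds.

Lemma gates_count_bound n T : (gates_count n T <= size T * (n + 2))%N.
Proof.
rewrite /gates_count; elim: T => //= x T IH.
by rewrite mulSn leq_add // leq_add2r leq_subr.
Qed.

(** The degree 4 comes from s times the gate count, each quadratic in Z = n + m. Consecutive powers
    of Z are compared beforehand, so that [lia] may treat them as atoms. *)
Lemma time_bound n m s g a C : (1000 <= C)%N -> (0 < n)%N -> (a <= n)%N ->
  (s <= 12 * (n * m))%N -> (g <= 3 * (n * n))%N ->
  (n.*2 * (26 * n + 61) + 3 * m + 25 + s * (g + g + n + a) +
   (n.*2 * (15 * n + 6 * s + 61) + 20) <= C * (n + m) ^ 4)%N.
Proof.
move=> C1000 n0 an sb gb; set Z := (n + m)%N.
have nZ : (n <= Z)%N by apply: leq_addr.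
have mZ : (m <= Z)%N by apply: leq_addl.
have sZ : (s <= 12 * (Z * Z))%N by apply: leq_trans sb _; rewrite leq_mul2l leq_mul.
have gZ : (g <= 3 * (Z * Z))%N by apply: leq_trans gb _; rewrite leq_mul2l leq_mul.
have t1 : (n.*2 * (26 * n + 61) <= Z * 2 * (26 * Z + 61))%N.
  by apply: leq_mul; lia.
have t2 : (s * (g + g + n + a) <= 12 * (Z * Z) * (6 * (Z * Z) + 2 * Z))%N.
  by apply: leq_mul => //; lia.
have t3 : (n.*2 * (15 * n + 6 * s + 61) <= Z * 2 * (15 * Z + 72 * (Z * Z) + 61))%N.
  by apply: leq_mul; lia.
have Z1 : (1 <= Z)%N by apply: leq_trans nZ.
have Z2 : (Z <= Z * Z)%N by rewrite leq_pmulr.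
have Z3 : (Z * Z <= Z * Z * Z)%N by rewrite leq_pmulr.
have Z4 : (Z * Z * Z <= Z * Z * Z * Z)%N by rewrite leq_pmulr.
have -> : (Z ^ 4 = Z * Z * Z * Z)%N by rewrite !expnS expn0 muln1 !mulnA.
have C4 : (1000 * (Z * Z * Z * Z) <= C * (Z * Z * Z * Z))%N by rewrite leq_mul.
apply: leq_trans C4; move: Z nZ mZ sZ gZ t1 t2 t3 Z1 Z2 Z3 Z4 => {}Z nZ mZ _ _.
move: (n.*2 * _)%N (n.*2 * _)%N (s * _)%N => x y z; lia.
Qed.

Theorem theorem9 (R : realType) :
  exists (K : nat) (G : 'I_K -> gate R) (gen post : cmd) (c d : nat),
    (forall i, valid_gate (G i)) /\
    forall (n : nat) (eps : R), (0 < n)%N -> 0 < eps ->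
    exists (s a : nat) (circ : circuit G (n + a))
           (guess : s.-tuple (bits (n + a)) -> nat) (tgen tpost : nat),
      let m := Num.truncn eps^-1 in
      (* classical generation of the circuit, and classical post-processing *)
      [/\ wf_circuit circ,
          computes gen [:: n; m] ([:: s; a] ++ encode_circuit circ) tgen &
          forall Y : s.-tuple (bits (n + a)),
            computes post
              ([:: n; m; s; a] ++ flatten [seq encode_bits y | y <- Y])
              [:: guess Y] tpost] /\
      (* number of copies, auxiliary qubits, depth, total running time *)
      [/\ s%:R <= c%:R * (ln n%:R / eps),
          a%:R <= c%:R * ln (n%:R : R),
          (depth circ)%:R <= c%:R * (n%:R * ln (n%:R : R)) &
          (tgen + s * (gate_count circ + depth circ + n + a) + tpost)%:R
            <= c%:R * (n%:R + eps^-1) ^+ d] /\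
      (* success probability on s independent runs of the same measurement *)
      forall (H : {group Zn n}) (psi : state R n),
        hidden_translation eps H psi ->
        2 / 3 <= \sum_(Y : s.-tuple (bits (n + a))
                        | <[inZp (guess Y) : Zn n]>%g == H :> {set Zn n})
                   \prod_(i < s) outcome_prob circ psi (tnth Y i).
Proof.
have [c0 hc0] := exp2_ln R.
(* The part 12 c0 pays for the copies, as s = 12 a m and a <= c0 ln n, and also covers ancillas and
   depth; 1000 and the exponent 4 are for the running time. *)
exists 2%N, (@gates R), gen_prog, post_prog, (12 * c0 + 1000)%N, 4%N.
split=> [i|n eps n0 eps0]; first exact: valid_gates.
set m := Num.truncn eps^-1; have [T2 Tk _] := tests_spec n0.
set T := tests n in T2 Tk; set a := size T.
set N := (n + a)%N; set s := (12 * a * m)%N.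
pose W (Y : s.-tuple (bits N)) :=
  [:: n; m; s; a] ++ flatten [seq encode_bits y | y <- Y].
pose guess Y := decode n (silent (W Y) n N s) T.
exists s, a, (tests_circuit R T n0), guess,
  (n.*2 * (26 * n + 61) + 3 * m + 25)%N, (n.*2 * (15 * n + 6 * s + 61) + 20)%N.
cbv zeta; split.
  split=> [||Y]; first exact: wf_tests_circuit.
  - by rewrite encode_tests_circuit //; apply: computes_gen.
  - exact: computes_post.
have [m_le [m_ge m_eq0]] := truncn_inv_bound eps0; rewrite -/m in m_le m_ge m_eq0.
have a_ln : a%:R <= c0%:R * ln (n%:R : R) by apply: hc0.
have an : (a <= n)%N by apply: leq_trans (ltnW (ltn_expl a (ltnSn 1))) T2.
have ln0 : 0 <= ln (n%:R : R) by rewrite ln_ge0 // ler1n.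
have cdepth : depth (tests_circuit R T n0) = gates_count n T.
  by have := encode_tests_circuit R n0 Tk; rewrite /encode_circuit => -[].
have ccount : gate_count (tests_circuit R T n0) = gates_count n T.
  rewrite -cdepth /gate_count /tests_circuit -map_comp /depth size_map.
  by elim: (tests_gates _ _ _) => //= g l ->.
have gb : (gates_count n T <= a * (n + 2))%N by apply: gates_count_bound.
have c0c (k : nat) (x : R) : 0 <= x -> (k <= 12)%N ->
    k%:R * (c0%:R * x) <= (12 * c0 + 1000)%:R * x.
  by move=> x0 k12; rewrite mulrA -natrM ler_wpM2r // ler_nat; nia.
split.
  split.
  - have -> : s%:R = 12%:R * (a%:R * m%:R) :> R by rewrite /s !natrM mulrA.
    apply: le_trans (c0c 12%N _ _ _) => //; last first.
      by rewrite divr_ge0 // ltW.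
    by rewrite ler_pM2l ?ltr0n // mulrA ler_pM.
  - have := c0c 1%N _ ln0 isT; rewrite mul1r; exact: le_trans.
  - rewrite cdepth; apply: le_trans (c0c 3%N _ _ _) => //; last by rewrite mulr_ge0.
    apply: (@le_trans _ _ (3 * (n%:R * a%:R))).
      by rewrite -!natrM ler_nat; apply: leq_trans gb _; nia.
    by rewrite ler_pM2l ?ltr0n // mulrCA ler_wpM2l.
  - rewrite cdepth ccount.
    apply: (@le_trans _ _ ((12 * c0 + 1000)%:R * (n + m)%:R ^+ 4)).
      rewrite -natrX -natrM ler_nat.
      have : (s <= 12 * (n * m))%N by rewrite /s; nia.
      have : (gates_count n T <= 3 * (n * n))%N by apply: leq_trans gb _; nia.
      by move=> g3 s12; apply: (time_bound _ n0 an s12 g3); apply: leq_addl.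
    apply: ler_wpM2l; first exact: ler0n.
    apply: lerXn2r; rewrite ?nnegrE ?ler0n //; last by rewrite natrD lerD2l.
    by rewrite addr_ge0 ?ler0n ?invr_ge0 ?ltW.
move=> H psi hid.
have psi1 : inner psi psi = 1 by case: hid.
(* Because k < n strictly, reduction modulo n leaves k alone, and the circuit and the promise speak
   of the same power of T. *)
have val_inZp (i : 'I_a) : nat_of_ord (inZp (nth (0, 0)%N T i).2 : Zn n) =
    (nth (0, 0)%N T i).2.
  by have [_ _ kn] := Tk i (ltn_ord i); rewrite /= prednK // modn_small.
have marg b (i : 'I_a) :
    \sum_(y : bits N | y (rshift n i) == b)
      outcome_prob (tests_circuit R T n0) psi y =
    2^-1 * (1 + (-1) ^+ b *
      complex.Re (inner psi (iter (nth (0, 0)%N T i).2 (@transl R n) psi))).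
  under eq_bigr do rewrite outcome_probE //.
  by rewrite run_tests_marginal sign_avg_norm.
pose inH (i : 'I_a) := (inZp (nth (0, 0)%N T i).2 : Zn n) \in H.
apply: (@success_probability _ _ _ a s (fun i (y : bits N) => y (rshift n i)) inH
  (fun Y => <[inZp (guess Y) : Zn n]>%g == H :> {set Zn n})).
- by move=> y; rewrite outcome_probE // nsq_ge0.
- under eq_bigr do rewrite outcome_probE //.
  by rewrite run_tests_total sum_nsq psi1.
(* For k in H outcome 1 has total probability 0, so each outcome string contributing to it has
   probability 0. *)
- move=> i y hi yi; have := hidden_translation_Re (inZp (nth (0, 0)%N T i).2) hid.
  rewrite -/(inH i) hi val_inZp => hRe.
  have := marg true i; rewrite hRe expr1 mulr1 subrr mulr0 => /eqP.
  rewrite psumr_eq0 => [/allP/(_ y)|z _]; last by rewrite outcome_probE // nsq_ge0.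
  by rewrite mem_index_enum yi eqxx /= => /(_ isT)/eqP.
- move=> i hi; have := hidden_translation_Re (inZp (nth (0, 0)%N T i).2) hid.
  rewrite -/(inH i) (negbTE hi) val_inZp => hRe.
  under eq_bigl do rewrite -eqbF_neg.
  rewrite marg expr0 mul1r.
  have q0 : 0 <= \sum_(y : bits N | y (rshift n i) == false)
      outcome_prob (tests_circuit R T n0) psi y.
    by apply: sumr_ge0 => y _; rewrite outcome_probE // nsq_ge0.
  rewrite marg expr0 mul1r in q0; set q := 2^-1 * _ in q0 *.
  have m0 : (0 < m)%N.
    by rewrite lt0n; apply/eqP => /m_eq0; rewrite ltNge (ltW hRe.1).
  have qe : q <= 1 - 2^-1 * eps by rewrite /q; move: hRe.2; lra.
  have e0 : 0 <= 2^-1 * eps by rewrite mulr_ge0 ?invr_ge0 // ltW.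
  have := bernoulli_inv s q0 e0 qe.
  (* Here s eps / 2 = 6 a m eps, and m eps >= 1/2. *)
  have : 3%:R * a%:R <= 1 + s%:R * (2^-1 * eps).
    have -> : s%:R * (2^-1 * eps) = 6%:R * a%:R * (m%:R * eps).
      by rewrite /s !natrM; field.
    have := ler_wpM2l (mulr_ge0 (ler0n R 6) (ler0n R a)) (m_ge m0); lra.
  have qs0 : 0 <= q ^+ s by rewrite exprn_ge0.
  move=> h1 h2; have := le_trans (ler_wpM2r qs0 h1) h2; rewrite -mulrA; lra.
move=> Y hY; apply/eqP; apply: decode_generates => // i hi.
by rewrite (silentE m Y (Ordinal hi)) -/(inH (Ordinal hi)) -hY.
Qed.
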